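(* For every real $u>1$ and every positive integer $d$ there exists $k>1$, depending only on $u$ and $d$, with the following property. Let $K$ be a finitely generated locally indicable group such that every finitely generated subgroup $H$ of $K$ either satisfies $\omega(H)\geq u$, or is isomorphic to $\mathbb{Z}^n$ for some $0\leq n\leq d$, or is isomorphic to the Klein bottle group. Then for any non-proper HNN extension $G=K\rtimes_\alpha\mathbb{Z}$, where $\alpha$ is an automorphism of $K$ having no periodic conjugacy classes, and for any finitely generated subgroup $S$ of $G$, either $\omega(S)\geq k$, or $S$ is isomorphic to $\mathbb{Z}^n$ for some $0\leq n\leq d$, or $S$ is isomorphic to the Klein bottle group.
   Context: For a finitely generated group $G$ and a finite generating set $A$ of $G$, let $\gamma_A(n)$ be the number of elements of $G$ of word length at most $n$ with respect to $A\cup A^{-1}$, and let $\omega(G,A)=\lim_{n\to\infty}\gamma_A(n)^{1/n}$ (the limit exists since $\gamma_A$ is submultiplicative). The growth constant of $G$ is $\omega(G)=\inf_A \omega(G,A)$, the infimum being over all finite generating sets $A$ of $G$. A group is locally indicable if every non-trivial finitely generated subgroup has a surjective homomorphism onto $\mathbb{Z}$. For an automorphism $\alpha$ of $K$, the non-proper HNN extension is $K\rtimes_\alpha\mathbb{Z}=\langle K,t\mid tkt^{-1}=\alpha(k)\ (k\in K)\rangle$. An automorphism $\alpha$ of $K$ has a periodic conjugacy class if there exist a non-identity element $x\in K$ and a non-zero integer $n$ such that $\alpha^n(x)$ is conjugate to $x$ in $K$. The Klein bottle group is $\langle a,b\mid bab^{-1}=a^{-1}\rangle$. *)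

(* Defs.v *)
From HB Require Import structures.
From mathcomp Require Import all_boot all_order all_algebra finmap.
From mathcomp Require Import all_classical all_reals all_analysis.
Import Order.TTheory GRing.Theory Num.Theory.
Import numFieldNormedType.Exports.

Set Implicit Arguments.
Unset Strict Implicit.
Unset Printing Implicit Defensive.

Local Open Scope group_scope.

(* Groups are [groupType]s and subgroups of [G] are [groupClosed G]s, i.e.
   boolean predicates closed under the group operations; under classical logic
   every subset is given by a boolean predicate, so these are all subgroups. *)
Definition subgroup (G : groupType) (S : groupClosed G) : Type := {x : G | x \in S}.

Section SubgroupIsGroup.
Variables (G : groupType) (S : groupClosed G).

Lemma subgroup_closed : group_closed S.
Proof. by split; [exact: gpred1 | exact: gpredF]. Qed.

HB.instance Definition _ := SubChoice.on (subgroup S).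
HB.instance Definition _ :=
  SubChoice_isSubGroup.Build G (fun x => x \in S) (subgroup S) subgroup_closed.
End SubgroupIsGroup.

Definition group_iso (G H : groupType) : Prop :=
  exists f : {multiplicative G -> H}, bijective f.

Definition intgroup : groupType := Algebra.to_multiplicative int.

Definition free_abelian (n : nat) : groupType := Algebra.to_multiplicative 'rV[int]_n.

Section Growth.
Variable G : groupType.
Implicit Types A : {fset G}.

Definition word_over A (w : seq G) : bool :=
  all (fun a => (a \in A) || (a^-1 \in A)) w.

Definition ball A (n : nat) : set G :=
  [set g | exists w : seq G,
     [/\ word_over A w, (size w <= n)%N & \prod_(a <- w) a = g]]%classic.

Definition generates A : Prop :=
  forall g : G, exists2 w : seq G, word_over A w & \prod_(a <- w) a = g.

Definition finitely_generated : Prop := exists A, generates A.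

(* [fset_set] is the empty set on infinite sets, whence the next lemma. *)
Lemma finite_ball A n : finite_set (ball A n).
Proof.
elim: n => [|n IHn].
  apply: (@sub_finite_set _ _ [set 1%g]%classic); last exact: finite_set1.
  by move=> g [w [_ /[!leqn0] /nilP-> <-]]; rewrite big_nil.
pose L : set G := ([set` A] `|` [set a^-1%g | a in [set` A]])%classic.
have finL : finite_set L.
  by rewrite finite_setU; split; [|apply: finite_image]; exact: finite_fset.
apply: (@sub_finite_set _ _
  ([set 1%g] `|` [set x.1 * x.2 | x in L `*` ball A n])%classic).
  move=> g [[|a w] [/= + szw <-]]; first by left; rewrite big_nil.
  move=> /andP[aA wA]; right; exists (a, \prod_(b <- w) b); last first.
    by rewrite big_cons.
  split=> /=; last by exists w.
  by case/orP: aA => aA; [left | right; exists a^-1; rewrite ?invgK].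
rewrite finite_setU; split; first exact: finite_set1.
by apply: finite_image; apply: finite_setX.
Qed.

Definition growth A (n : nat) : nat := #|` fset_set (ball A n) |.

Definition growth_rate (R : realType) A : R :=
  limn (fun n : nat => ((growth A n)%:R `^ (n%:R^-1))%R).

(* The infimum is taken over all finite generating sets of [G]; it is
   meaningful for finitely generated [G] only. *)
Definition growth_constant (R : realType) : R :=
  inf [set growth_rate R A | A in [set A | generates A]]%classic.

End Growth.

Definition locally_indicable (G : groupType) : Prop :=
  forall H : groupClosed G, finitely_generated (subgroup H) ->
    (exists h : subgroup H, h != 1) ->
    exists f : {multiplicative subgroup H -> intgroup},
      forall m : intgroup, exists h : subgroup H, f h = m.

(* [G] has the presentation < a, b | b a b^-1 = a^-1 >, expressed by the
   universal property of the presented group. *)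
Definition is_klein_bottle_group (G : groupType) : Prop :=
  exists a b : G, b * a * b^-1 = a^-1 /\
    forall (L : groupType) (x y : L), y * x * y^-1 = x^-1 ->
      exists f : {multiplicative G -> L}, [/\ f a = x, f b = y &
        forall f' : {multiplicative G -> L}, f' a = x -> f' b = y -> f' =1 f].

Record automorphism (K : groupType) := Automorphism {
  aut :> {multiplicative K -> K};
  aut_inv : K -> K;
  autK : cancel aut aut_inv;
  autVK : cancel aut_inv aut
}.

Section Automorphisms.
Variables (K : groupType) (alpha : automorphism K).

Definition autz (n : int) (x : K) : K :=
  match n with
  | Posz m => iter m alpha x
  | Negz m => iter m.+1 (aut_inv alpha) x
  end.

Definition has_periodic_conjugacy_class : Prop :=
  exists (x : K) (n : int), [/\ x != 1, n != 0%R &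
    exists y : K, autz n x = x ^ y].

Lemma aut_invM : {morph aut_inv alpha : x y / x * y}.
Proof.
by move=> x y; apply: (can_inj (autK alpha)); rewrite gmulfM !autVK.
Qed.

Lemma autzM n : {morph autz n : x y / x * y}.
Proof.
case: n => n x y /=.
  by elim: n => //= n ->; rewrite gmulfM.
by elim: n => [|n IHn] /=; rewrite ?aut_invM // -aut_invM -IHn.
Qed.

Lemma autz0 x : autz 0 x = x. Proof. by []. Qed.

Lemma autz1 x : autz 1 x = alpha x. Proof. by []. Qed.

Lemma autzS n x : autz (n + 1)%R x = alpha (autz n x).
Proof.
case: n => [n|[|n]]; first by rewrite addrC -intS.
  by rewrite /= autVK.
have -> : (Negz n.+1 + 1)%R = Negz n by rewrite !NegzE (intS n.+1) opprD addrC addrA subrr add0r.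
by rewrite autVK.
Qed.

Lemma autzB n x : autz (n - 1)%R x = aut_inv alpha (autz n x).
Proof. by rewrite -[n in RHS](subrK 1%R) autzS autK. Qed.

Lemma autzD m n x : autz (m + n)%R x = autz m (autz n x).
Proof.
elim/int_rec: m => [|m IHm|m IHm]; first by rewrite add0r.
  by rewrite -addn1 PoszD addrAC !autzS IHm.
by rewrite -addn1 PoszD opprD addrAC !autzB IHm.
Qed.

Lemma autz_1 n : autz n 1 = 1.
Proof. by apply: (@mulgI _ (autz n 1)); rewrite -autzM !mulg1. Qed.

End Automorphisms.

(* The semidirect product of K by Z; the pair (k, m) stands for k t^m. *)
Definition sdprodZ (K : groupType) (alpha : automorphism K) : Type :=
  (K * int)%type.

Arguments autz : simpl never.

Section SemidirectProduct.
Variables (K : groupType) (alpha : automorphism K).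

HB.instance Definition _ := Choice.on (sdprodZ alpha).

Definition sdprodZ_mul (g h : sdprodZ alpha) : sdprodZ alpha :=
  (g.1 * autz alpha g.2 h.1, (g.2 + h.2)%R).
Definition sdprodZ_one : sdprodZ alpha := (1, 0%R).
Definition sdprodZ_inv (g : sdprodZ alpha) : sdprodZ alpha :=
  (autz alpha (- g.2)%R g.1^-1, (- g.2)%R).

Lemma sdprodZ_mulA : associative sdprodZ_mul.
Proof.
by move=> x y z; rewrite /sdprodZ_mul /= autzM autzD mulgA addrA.
Qed.

Lemma sdprodZ_mul1 : left_id sdprodZ_one sdprodZ_mul.
Proof. by move=> [k m]; rewrite /sdprodZ_mul /= autz0 mul1g add0r. Qed.

Lemma sdprodZ_mulr1 : right_id sdprodZ_one sdprodZ_mul.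
Proof. by move=> [k m]; rewrite /sdprodZ_mul /= autz_1 mulg1 addr0. Qed.

Lemma sdprodZ_mulV : left_inverse sdprodZ_one sdprodZ_inv sdprodZ_mul.
Proof.
by move=> [k m]; rewrite /sdprodZ_mul /= -autzM mulVg autz_1 addNr.
Qed.

Lemma sdprodZ_mulrV : right_inverse sdprodZ_one sdprodZ_inv sdprodZ_mul.
Proof.
by move=> [k m]; rewrite /sdprodZ_mul /= -autzD subrr autz0 mulgV.
Qed.

HB.instance Definition _ := isGroup.Build (sdprodZ alpha)
  sdprodZ_mulA sdprodZ_mul1 sdprodZ_mulr1 sdprodZ_mulV sdprodZ_mulrV.

Lemma sdprodZ_mulE (g h : sdprodZ alpha) :
  g * h = (g.1 * autz alpha g.2 h.1, (g.2 + h.2)%R).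
Proof. by []. Qed.

Lemma sdprodZ_invE (g : sdprodZ alpha) :
  g^-1 = (autz alpha (- g.2)%R g.1^-1, (- g.2)%R).
Proof. by []. Qed.

Definition sdprodZ_incl (k : K) : sdprodZ alpha := (k, 0%R).
Definition sdprodZ_t : sdprodZ alpha := (1, 1%R).

Lemma sdprodZ_inclM : {morph sdprodZ_incl : x y / x * y}.
Proof. by []. Qed.

HB.instance Definition _ :=
  isMultiplicative.Build K (sdprodZ alpha) sdprodZ_incl sdprodZ_inclM.

End SemidirectProduct.

Section IntegerPowers.
Variable L : groupType.

Definition gexpz (x : L) (n : int) : L :=
  match n with Posz m => x ^+ m | Negz m => x ^- m.+1 end.

Lemma gexpzS x n : gexpz x (n + 1)%R = gexpz x n * x.
Proof.
case: n => [n|[|n]]; first by rewrite addrC -intS /= expgSr.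
  by rewrite /= expg1 mulVg.
have -> : (Negz n.+1 + 1)%R = Negz n by rewrite !NegzE (intS n.+1) opprD addrC addrA subrr add0r.
by rewrite /= (expgS x n.+1) invgM mulgVK.
Qed.

Lemma gexpzB x n : gexpz x (n - 1)%R = gexpz x n * x^-1.
Proof. by rewrite -[n in RHS](subrK 1%R) gexpzS mulgK. Qed.

Lemma gexpzD x m n : gexpz x (m + n)%R = gexpz x m * gexpz x n.
Proof.
elim/int_rec: n => [|n IHn|n IHn]; first by rewrite addr0 /= mulg1.
  by rewrite -addn1 PoszD addrA !gexpzS IHn mulgA.
by rewrite -addn1 PoszD opprD addrA !gexpzB IHn mulgA.
Qed.

End IntegerPowers.

Lemma gmulf_one (G H : groupType) (f : {multiplicative G -> H}) : f 1 = 1.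
Proof. by apply: (@mulgI _ (f 1)); rewrite -gmulfM !mulg1. Qed.

Lemma gmulf_inv (G H : groupType) (f : {multiplicative G -> H}) x :
  f x^-1 = (f x)^-1.
Proof. by apply: (@mulgI _ (f x)); rewrite -gmulfM !mulgV gmulf_one. Qed.

Section Presentations.
Variables (K : groupType) (alpha : automorphism K).

(* [sdprodZ alpha] is the HNN extension < K, t | t k t^-1 = alpha k >. *)
Lemma sdprodZ_rel (k : K) :
  sdprodZ_t alpha * sdprodZ_incl alpha k * (sdprodZ_t alpha)^-1 =
  sdprodZ_incl alpha (alpha k).
Proof.
apply/(canLR (mulgK _)); rewrite /sdprodZ_incl /sdprodZ_t.
by congr pair => /=; rewrite mul1g mulg1.
Qed.

Section UniversalProperty.
Variables (L : groupType) (phi : {multiplicative K -> L}) (y : L).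
Hypothesis rel : forall k, y * phi k * y^-1 = phi (alpha k).

Definition sdprodZ_lift (g : sdprodZ alpha) : L := phi g.1 * gexpz y g.2.

Lemma rel_inv k : y^-1 * phi k = phi (aut_inv alpha k) * y^-1.
Proof. by rewrite -[k in LHS](autVK alpha) -rel !mulgA mulVg mul1g. Qed.

Lemma rel_gexpz m k : gexpz y m * phi k = phi (autz alpha m k) * gexpz y m.
Proof.
elim/int_rec: m k => [|m IHm|m IHm] k; first by rewrite /= mul1g mulg1.
  rewrite -addn1 PoszD addrC autzD gexpzD -mulgA IHm !mulgA; congr (_ * _).
  by rewrite autz1 -rel mulgVK.
rewrite -addn1 PoszD opprD addrC autzD gexpzD -mulgA IHm !mulgA; congr (_ * _).
by rewrite -rel_inv.
Qed.

Lemma sdprodZ_liftM : {morph sdprodZ_lift : g h / g * h}.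
Proof.
move=> [k m] [l n]; rewrite /sdprodZ_lift /= gmulfM gexpzD.
by rewrite -!mulgA; congr (_ * _); rewrite !mulgA rel_gexpz.
Qed.

HB.instance Definition _ :=
  isMultiplicative.Build (sdprodZ alpha) L sdprodZ_lift sdprodZ_liftM.

Lemma sdprodZ_universal :
  exists f : {multiplicative sdprodZ alpha -> L},
    [/\ forall k, f (sdprodZ_incl alpha k) = phi k, f (sdprodZ_t alpha) = y &
      forall f' : {multiplicative sdprodZ alpha -> L},
        (forall k, f' (sdprodZ_incl alpha k) = phi k) ->
        f' (sdprodZ_t alpha) = y -> f' =1 f].
Proof.
exists sdprodZ_lift; split=> [k| |f' f'K f't [k m]] /=.
- by rewrite /sdprodZ_lift /= mulg1.
- by rewrite /sdprodZ_lift /= gmulf_one mul1g expg1.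
have ft n : f' (1, n) = gexpz y n.
  elim/int_rec: n => [|n IHn|n IHn]; first exact: gmulf_one.
    rewrite -addn1 PoszD gexpzS -IHn -f't -gmulfM.
    by rewrite sdprodZ_mulE /= autz_1 mulg1.
  rewrite -addn1 PoszD opprD gexpzB -IHn -f't -gmulf_inv -gmulfM.
  by rewrite sdprodZ_mulE sdprodZ_invE /= invg1 !autz_1 mulg1.
by rewrite /sdprodZ_lift -f'K -ft -gmulfM sdprodZ_mulE /= mulg1 add0r.
Qed.

End UniversalProperty.
End Presentations.

Section KleinBottle.

Definition intgroup_opp (m : intgroup) : intgroup := (- (m : int))%R.

Lemma intgroup_oppM : {morph intgroup_opp : x y / x * y}.
Proof. exact: opprD. Qed.

HB.instance Definition _ :=
  isMultiplicative.Build intgroup intgroup intgroup_opp intgroup_oppM.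

Lemma intgroup_oppK : cancel intgroup_opp intgroup_opp.
Proof. exact: opprK. Qed.

Definition intgroup_flip : automorphism intgroup :=
  @Automorphism intgroup intgroup_opp intgroup_opp intgroup_oppK intgroup_oppK.

Definition gexpzZ (L : groupType) (x : L) (m : intgroup) : L := gexpz x m.

Lemma gexpzZM (L : groupType) (x : L) : {morph gexpzZ x : m n / m * n}.
Proof. exact: gexpzD. Qed.

HB.instance Definition _ (L : groupType) (x : L) :=
  isMultiplicative.Build intgroup L (gexpzZ x) (gexpzZM x).

Lemma gexpzZ_unique (L : groupType) (x : L) (f : intgroup -> L) :
  {morph f : m n / m * n} -> f (1%R : int) = x -> f =1 gexpzZ x.
Proof.
move=> fM fx; have fD (m n : int) : f (m + n)%R = f m * f n by exact: fM.
have f0 : f (0%R : int) = 1 by apply: (@mulgI _ (f (0%R : int))); rewrite -fD mulg1.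
have fN : f (-1 : int)%R = x^-1.
  by apply: (@mulgI _ (f (1%R : int))); rewrite -fD subrr f0 fx mulgV.
move=> m; elim/int_rec: (m : int) => [|n IHn|n IHn]; first exact: f0.
  by rewrite -addn1 PoszD fD IHn fx /gexpzZ gexpzS.
by rewrite -addn1 PoszD opprD fD IHn fN /gexpzZ gexpzB.
Qed.

(* The presentation of the Klein bottle group is realised. *)
Lemma is_klein_bottle_group_sdprodZ :
  is_klein_bottle_group (sdprodZ intgroup_flip).
Proof.
exists (sdprodZ_incl intgroup_flip (1%R : int)), (sdprodZ_t intgroup_flip).
split=> [|L x y xy]; first by rewrite sdprodZ_rel.
have rel k : y * gexpzZ x k * y^-1 = gexpzZ x (intgroup_flip k).
  have := @gexpzZ_unique L x^-1 (fun m => y * gexpzZ x m * y^-1).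
  move=> ->; last by rewrite /gexpzZ /= expg1.
    have := @gexpzZ_unique L x^-1 (fun m => gexpzZ x (intgroup_flip m)).
    move=> -> //; first by move=> m n; rewrite !gmulfM.
  by move=> m n; rewrite gmulfM !mulgA mulgVK.
have [f [fK ft f_uniq]] := sdprodZ_universal rel.
exists f; split=> // f' f'a f'b; apply: f_uniq => //.
apply: (@gexpzZ_unique L x (fun m => f' (sdprodZ_incl intgroup_flip m))) => //.
by move=> m n; rewrite !gmulfM.
Qed.

End KleinBottle.

(* Main.v *)
Require Import Defs.
From HB Require Import structures.
From mathcomp Require Import all_boot all_order all_algebra finmap.
From mathcomp Require Import all_field zify ring.
From mathcomp Require Import all_classical all_reals all_analysis.
Import Order.TTheory GRing.Theory Num.Theory.
Import numFieldNormedType.Exports.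

(** Suppose that [S] is not contained in [K], let [a] be a generator of [S] with
    non-zero exponent sum in [t], and let [y] be a non-trivial commutator
    [[~ a, b]] with another generator; the absence of periodic conjugacy classes
    makes [y] exist unless [S] is infinite cyclic. Write [y_i = a^i y a^-i].

    If for some bounded [p] the products [y_0^e_0 y_p^e_1 ... y_{p(n-1)}^e_{n-1}]
    with [e_i] in {0, 1} are all distinct, then [S] has uniform exponential
    growth. Otherwise the group [H(y)] generated by the [y_i] is finitely
    generated, so local indicability gives a homomorphism [f : H(y) -> Z] with
    [f y_0 <> 0], and the integer sequence [s_i = f y_i] satisfies, along every
    progression of bounded step [p], a linear recurrence with coefficients in
    {-1, 0, 1}. Moreover any [D + 1] elements of [K] of bounded length generate
    a subgroup which either grows at rate at least [u], or is [Z^n] or a Klein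
    bottle group, and then their squares satisfy a non-trivial relation in an
    abelian group of rank at most [D = max d 2]; so [s] satisfies recurrences of
    order [D] as well. By Kronecker's theorem the characteristic roots of [s]
    are zero or roots of unity of bounded order: a fixed polynomial
    [(t (t^P - 1))^D] annihilates [s]. Applying it to [y] gives a new element
    [z_1] of bounded length, non-trivial because there are no periodic conjugacy
    classes, such that [f] vanishes on [H(z_1)]. Iterating, we get [D + 1]
    elements [y = z_0, z_1, ..., z_D] which are independent because of the
    functionals [f], whereas their squares must satisfy a relation. *)

Set Implicit Arguments.
Unset Strict Implicit.
Unset Printing Implicit Defensive.

Local Open Scope ring_scope.

(** * A uniform Kronecker theorem *)

(** Each new factor [X - z] with [|z| <= 2] multiplies the bound on the coefficients by at most
    [1 + 2]. *)
Lemma coef_prod_XsubC_le (rs : seq algC) (i : nat) :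
  {in rs, forall z, `|z| <= 2} -> `|(\prod_(z <- rs) ('X - z%:P))`_i| <= 3 ^+ size rs.
Proof.
elim: rs i => [|z rs IH] i rs2; first by rewrite big_nil coef1; case: eqP; rewrite ?normr0 ?normr1.
have {}IH j : `|(\prod_(y <- rs) ('X - y%:P))`_j| <= 3 ^+ size rs.
  by apply: IH => y ys; apply: rs2; rewrite inE ys orbT.
have z2 : `|z| <= 2 by apply: rs2; rewrite mem_head.
rewrite big_cons mulrBl coefB coefXM coefCM.
apply: (le_trans (ler_normB _ _)); rewrite exprS.
have -> x : 3 * x = x + 2 * x :> algC by rewrite -[X in X + _]mul1r -mulrDl -natr1 addrC.
rewrite normrM; apply: lerD; last exact: ler_pM.
by case: (i == 0)%N; [rewrite normr0 exprn_ge0 | exact: IH].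
Qed.

(** If [|z| > 2], isolating the leading term gives [|z|^n <= 1 + |z| + ... + |z|^(n-1) = (|z|^n - 1)
    / (|z| - 1) < |z|^n]. *)
Lemma root_small_coef_le2 (e : {poly algC}) (z : algC) :
  lead_coef e ^+ 2 = 1 -> (forall i, `|e`_i| <= 1) -> root e z -> `|z| <= 2.
Proof.
move=> e1 ele /rootP ez.
have [//|z2] := real_leP (normr_real z) (realn algC 2).
have z1 : 0 < `|z| - 1 by rewrite subr_gt0 (lt_trans _ z2) // ltr1n.
have le1 : `|lead_coef e| = 1.
  by apply/eqP; rewrite -sqrp_eq1 // -normrX e1 normr1.
case: (posnP (size e)) => [|/prednK szE].
  by move/eqP; rewrite size_poly_eq0 => /eqP e0; move: le1; rewrite e0 lead_coef0 normr0 => /eqP; rewrite eq_sym oner_eq0.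
move: ez; rewrite horner_coef -szE big_ord_recr /= => /eqP; rewrite addrC addr_eq0 => /eqP ez.
set n := (size e).-1 in szE ez.
have: `|z| ^+ n <= \sum_(i < n) `|z| ^+ i.
  rewrite -[leLHS]mul1r -le1 -normrX -normrM ez normrN.
  apply: (le_trans (ler_norm_sum _ _ _)); apply: ler_sum => i _.
  by rewrite normrM normrX ler_piMl // exprn_ge0.
move=> h; have: (`|z| - 1) * `|z| ^+ n <= `|z| ^+ n - 1 by rewrite subrX1 ler_pM2l.
have h2 : `|z| ^+ n * 2 <= `|z| ^+ n * `|z| by rewrite ler_wpM2l ?exprn_ge0 // ltW.
rewrite mulrBl mul1r lerBlDr [_ * `|z| ^+ n]mulrC => /(le_trans h2).
by rewrite mulr_natr mulr2n addrAC lerDl oppr_ge0 ler10.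
Qed.

Lemma lead_coef_sqr1 (e : {poly int}) :
  e != 0 -> (forall i, `|e`_i| <= 1) -> lead_coef e ^+ 2 = 1.
Proof.
rewrite -lead_coef_eq0 => e0 /(_ (size e).-1); rewrite -/(lead_coef e).
by case: (lead_coef e) e0 => [[|[|n]]|[|n]].
Qed.

(** Pigeonhole: the minimal polynomials of the powers [z^p] are integral of degree at most [D] with
    coefficients bounded by [3^D], so these powers take fewer than [N] values. Two of the first [N]
    powers coincide, and a non-zero [z] can be cancelled. *)
Lemma kronecker_finite (D : nat) : exists N, (0 < N)%N /\ forall z : algC,
  (forall p, (0 < p <= N)%N ->
     [/\ z ^+ p \in Aint, (size (minCpoly (z ^+ p)) <= D.+1)%N &
        forall y, root (minCpoly (z ^+ p)) y -> `|y| <= 2]) ->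
  z = 0 \/ exists2 q, (0 < q <= N)%N & z ^+ q = 1.
Proof.
have [B BE] : exists B : nat, B%:R = 3 ^+ D :> algC by exists (3 ^ D)%N; rewrite natrX.
pose code : finType := ({ffun 'I_D.+1 -> 'I_(B + B).+1} * 'I_D.+1)%type.
exists #|code|.+1; split=> // z zP.
have [->|z0] := eqVneq z 0; first by left.
right.
have rootsP (p : {poly algC}) : {rs | p \is monic -> p = \prod_(y <- rs) ('X - y%:P)}.
  have [rs rsE] := closed_field_poly_normal p.
  by exists rs => /monicP p1; rewrite {1}rsE p1 scale1r.
pose rts (x : algC) := sval (rootsP (minCpoly x)).
have rtsE x : minCpoly x = \prod_(y <- rts x) ('X - y%:P).
  exact: (svalP (rootsP (minCpoly x))) (minCpoly_monic x).
(* The coefficients lie in [[-B, B]]; adding [B] makes them naturals at most [2 B], so that [absz]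
   and [inord] lose nothing. The index among the roots separates conjugates sharing a minimal
   polynomial. *)
pose enc (x : algC) : code :=
  ([ffun i : 'I_D.+1 => inord (absz (Num.floor (minCpoly x)`_i + B%:Z))],
   inord (index x (rts x))).
have rtsD (p : 'I_#|code|.+1) : [/\ (size (rts (z ^+ p.+1)) <= D)%N,
    {in rts (z ^+ p.+1), forall y, `|y| <= 2} &
    minCpoly (z ^+ p.+1) \is a polyOver Num.int].
  have [|zint zsz zrt] := zP p.+1; first by rewrite ltn_ord.
  split=> //; first by move: zsz; rewrite rtsE size_prod_XsubC.
  by move=> y yr; apply: zrt; rewrite rtsE root_prod_XsubC.
have enc_inj (p q : 'I_#|code|.+1) : enc (z ^+ p.+1) = enc (z ^+ q.+1) ->
    z ^+ p.+1 = z ^+ q.+1.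
  have [] := rtsD p; have [] := rtsD q.
  move: (z ^+ p.+1) (z ^+ q.+1) => x y ysz y2 yint xsz x2 xint [/ffunP cE iE].
  have coefE w i : (size (rts w) <= D)%N -> {in rts w, forall y, `|y| <= 2} ->
      minCpoly w \is a polyOver Num.int ->
      (absz (Num.floor (minCpoly w)`_i + B%:Z)%R <= B + B)%N /\
      (minCpoly w)`_i = ((absz (Num.floor (minCpoly w)`_i + B%:Z))%:Z - B%:Z)%:~R.
    move=> wsz w2 /polyOverP /(_ i) wint.
    have : `|(minCpoly w)`_i| <= B%:R.
      rewrite rtsE BE; apply: le_trans (coef_prod_XsubC_le _ w2) _.
      by rewrite ler_weXn2l // ler1n.
    have /intrP[k ->] := wint.
    rewrite intrKfloor -intr_norm -[B%:R]/(B%:Z%:~R) ler_int => kB.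
    have [k1 k2] : -B%:Z <= k /\ k <= B%:Z by move: kB; rewrite ler_norml => /andP.
    have kB0 : 0 <= k + B%:Z by rewrite -lerBlDr sub0r.
    by split; rewrite ?gez0_abs ?addrK // -lez_nat gez0_abs // PoszD lerD2r.
  have xyE : minCpoly x = minCpoly y.
    apply/polyP => i; have [iD|iD] := ltnP i D.+1; last first.
      by rewrite !nth_default // rtsE size_prod_XsubC (leq_trans _ iD).
    have [xB ->] := coefE x i xsz x2 xint; have [yB ->] := coefE y i ysz y2 yint.
    have := congr1 val (cE (Ordinal iD)); rewrite !ffunE /=.
    by rewrite !inordK ?ltnS // => ->.
  have rE : rts x = rts y by rewrite /rts xyE.
  have inx w : w \in rts w by rewrite -root_prod_XsubC -rtsE root_minCpoly.
  have := congr1 val iE; rewrite /= !inordK; first last.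
  - by rewrite ltnS (leq_trans _ xsz) // index_size.
  - by rewrite ltnS (leq_trans _ ysz) // index_size.
  by rewrite rE => /(congr1 (nth 0 (rts y))); rewrite !nth_index // -rE.
have /injectivePn[p [q pq]] : ~~ injectiveb (fun p : 'I_#|code|.+1 => enc (z ^+ p.+1)).
  by apply/negP => /injectiveP/leq_card; rewrite card_ord ltnn.
move/enc_inj.
wlog lt_pq : p q pq / (p < q)%N.
  move=> W; case: (ltngtP p q) => [|lt_qp|/val_inj/eqP]; first exact: W.
    by move/esym; apply: W => //; rewrite eq_sym.
  by rewrite (negbTE pq).
move=> zE; exists (q - p)%N.
  by rewrite subn_gt0 lt_pq (leq_trans (leq_subr _ _)) // ltnW.
apply: (mulfI (expf_neq0 p.+1 z0)).
have zq : z ^+ p.+1 * z ^+ (q - p)%N = z ^+ q.+1.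
  by rewrite -exprD addSn subnKC // ltnW.
by rewrite zq -zE [RHS]mulr1.
Qed.

(** * Sequences as linear forms on polynomials *)

Section LinearForm.
Variables (F : fieldType) (s : nat -> F).
Implicit Types g h : {poly F}.

(** The linear form sending [X^n] to [s n]; multiplication by [X] then corresponds to the shift of
    [s], and recurrences become ideals of polynomials. *)
Definition seq_form g : F := \sum_(i < size g) g`_i * s i.

Lemma seq_formE n g : (size g <= n)%N -> seq_form g = \sum_(i < n) g`_i * s i.
Proof.
move=> gn; rewrite /seq_form (big_ord_widen _ (fun i => g`_i * s i) gn) big_mkcond.
by apply: eq_bigr => i _; case: ltnP => // gi; rewrite nth_default ?mul0r.
Qed.

Lemma seq_form_is_linear : linear_for *%R seq_form.
Proof.
move=> a g h; pose n := maxn (size g) (size h).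
have gn : (size g <= n)%N by rewrite leq_maxl.
have hn : (size h <= n)%N by rewrite leq_maxr.
have ghn : (size (a *: g + h)%R <= n)%N.
  by rewrite (leq_trans (size_polyD _ _)) // geq_max hn (leq_trans (size_scale_leq _ _)).
rewrite (seq_formE gn) (seq_formE hn) (seq_formE ghn) mulr_sumr -big_split.
by apply: eq_bigr => i _ /=; rewrite coefD coefZ mulrDl mulrA.
Qed.

HB.instance Definition _ :=
  GRing.isLinear.Build F {poly F} F *%R seq_form seq_form_is_linear.

Lemma seq_formXn n : seq_form 'X^n = s n.
Proof.
rewrite /seq_form size_polyXn big_ord_recr /= coefXn eqxx mul1r big1 ?add0r // => i _.
by rewrite coefXn ltn_eqF ?ltn_ord // mul0r.
Qed.

Definition annihilates g := forall l, seq_form ('X^l * g) = 0.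

Lemma annihilatesMl h g : annihilates g -> annihilates (h * g).
Proof.
move=> Ig l; rewrite mulrA -[_ * h]coefK poly_def mulr_suml linear_sum big1 // => i _.
by rewrite -scalerAl linearZ /= Ig mulr0.
Qed.

Lemma annihilatesB g h : annihilates g -> annihilates h -> annihilates (g - h).
Proof. by move=> Ig Ih l; rewrite mulrBr linearB /= Ig Ih subrr. Qed.

Lemma annihilates_comp_poly p n (c : nat -> F) :
  (forall l, \sum_(i < n) c i * s (p * i + l)%N = 0) ->
  annihilates ((\poly_(i < n) c i) \Po 'X^p).
Proof.
move=> cs l; rewrite poly_def linear_sum mulr_sumr linear_sum -[RHS](cs l).
apply: eq_bigr => i _; rewrite /= comp_polyZ comp_Xn_poly -exprM.
by rewrite -scalerAr linearZ /= -exprD seq_formXn addnC.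
Qed.

(** The annihilating polynomials form an ideal; a non-zero one of least size divides all others,
    since the remainder of a division by it is again annihilating. *)
Lemma annihilator_principal g : g != 0 -> annihilates g ->
  exists m, [/\ m != 0, annihilates m & forall h, annihilates h -> m %| h].
Proof.
move=> g0 Ig.
pose P n := `[< exists h, [/\ h != 0, annihilates h & size h = n] >].
have exP : exists n, P n by exists (size g); apply/asboolP; exists g.
case: (ex_minnP exP) => n /asboolP[m [m0 Im mn]] minm.
exists m; split=> // h Ih; apply/modp_eq0P/eqP; apply: contraTT (ltn_modpN0 h m0) => hm0.
rewrite -leqNgt mn; apply: minm; apply/asboolP; exists (h %% m); split=> //.
have -> : h %% m = h - h %/ m * m by rewrite {2}(divp_eq h m) addrC addKr.
by apply: annihilatesB => //; apply: annihilatesMl.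
Qed.

End LinearForm.

(* Kronecker's theorem made uniform: the two families of relations force the
   powers [z ^+ p], for [z] a root of the characteristic polynomial of [s], to
   be algebraic integers of degree at most [D] with all conjugates in the disc
   of radius 2; there are finitely many of those, so [z] is zero or a root of
   unity of bounded order. *)
Lemma uniform_kronecker (D : nat) : exists N P : nat, [/\ (0 < N)%N, (0 < P)%N &
  forall s : nat -> int,
  (forall p, (0 < p <= N)%N -> exists c : nat -> int,
     (exists2 i, (i <= D)%N & c i != 0) /\
     forall l, \sum_(i < D.+1) c i * s (p * i + l)%N = 0) ->
  (forall p, (0 < p <= N)%N -> exists n (e : nat -> int),
     [/\ forall i, `|e i| <= 1, exists2 i, (i < n)%N & e i != 0 &
     forall l, \sum_(i < n) e i * s (p * i + l)%N = 0]) ->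
  forall l, iter D (fun r i => r (i + P).+1 - r i.+1) s l = 0].
Proof.
have [N [N0 kronN]] := kronecker_finite D.
(* The factorial of [N] is a common multiple of all the possible orders [q <= N] of roots of
   unity. *)
exists N, N`!; split=> // [|s cs es]; first exact: fact_gt0.
pose sC i : algC := (s i)%:~R.
have lift n (e : nat -> int) p :
    (forall l, \sum_(i < n) e i * s (p * i + l)%N = 0) ->
    annihilates sC (map_poly intr (\poly_(i < n) e i) \Po 'X^p).
  move=> es0; have -> : map_poly intr (\poly_(i < n) e i) = \poly_(i < n) (e i)%:~R :> {poly algC}.
    by apply/polyP => i; rewrite coef_map !coef_poly; case: ifP.
  apply: annihilates_comp_poly => l; rewrite -[RHS]/(0%:~R) -(es0 l) raddf_sum.
  by apply: eq_bigr => i _; rewrite /= intrM.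
have nz n (e : nat -> int) i : (i < n)%N -> e i != 0 -> \poly_(i < n) e i != 0.
  by move=> i_n; apply: contra => /eqP/polyP/(_ i); rewrite coef_poly i_n coef0 => ->.
have [m [m0 Im minm]] : exists m, [/\ m != 0, annihilates sC m &
    forall h, annihilates sC h -> m %| h].
  have [|c [[i iD ci0] /lift Ic]] := cs 1%N; first by rewrite N0.
  apply: annihilator_principal Ic; rewrite expr1 comp_polyXr.
  by rewrite map_poly_eq0_id0 ?intr_eq0 ?lead_coef_eq0; apply: nz ci0.
have rootm z : root m z -> z * (z ^+ N`! - 1) = 0.
  move=> mz.
  have mrel n (e : nat -> int) p : (forall l, \sum_(i < n) e i * s (p * i + l)%N = 0) ->
      root (map_poly intr (\poly_(i < n) e i)) (z ^+ p).
    move=> /lift/minm/root_dvdp/(_ mz).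
    by rewrite /root horner_comp hornerXn.
  have [p pN|->|[q /andP[q0 qN] zq]] := kronN z; last 2 first.
  - by rewrite mul0r.
  - have /dvdnP[k ->] : (q %| N`!)%N by apply: dvdn_fact; rewrite q0.
    by rewrite mulnC exprM zq expr1n subrr mulr0.
  have [c [[i iD ci0] /mrel cz]] := cs p pN.
  have [n [e [e1 [j jn ej0] /mrel ez]]] := es p pN.
  move: (z ^+ p) cz ez => y.
  set C := \poly_(i < D.+1) c i; set E := \poly_(i < n) e i => cy ey.
  have C0 : C != 0 by apply: nz ci0.
  have E0 : E != 0 by apply: nz ej0.
  have Ecoef k : `|E`_k| <= 1 by rewrite coef_poly; case: ifP; rewrite ?normr0.
  have E1 := lead_coef_sqr1 E0 Ecoef.
  have EC1 : lead_coef (map_poly intr E : {poly algC}) ^+ 2 = 1.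
    by rewrite lead_coef_map_eq ?intr_eq0 ?lead_coef_eq0 // -rmorphXn /= E1.
  (* The minimal polynomial [q] of [y = z^p] over the rationals divides both relations. [C] bounds
     its degree by [D]; [E] is monic up to sign, so [y] is an algebraic integer, and its small
     coefficients put all conjugates in the disc of radius 2. *)
  have [q [qE q_monic qP]] := minCpolyP y.
  have ratE (g : {poly int}) : map_poly intr g = map_poly ratr (map_poly intr g) :> {poly algC}.
    by rewrite -map_poly_comp; apply: eq_map_poly => k /=; rewrite ratr_int.
  split.
  - apply: (@root_monic_Aint (lead_coef (map_poly intr E) *: map_poly intr E)).
    + by rewrite rootZ // -sqrf_eq0 EC1 oner_neq0.
    + by apply/monicP; rewrite lead_coefZ -expr2.
    + apply: polyOverZ; first by rewrite lead_coef_map_eq ?intr_eq0 ?lead_coef_eq0 // intr_int.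
      by apply/polyOverP => k; rewrite coef_map intr_int.
  - rewrite qE size_map_poly.
    have : q %| map_poly intr C by rewrite -qP -ratE.
    move/(dvdp_leq _); rewrite map_poly_eq0_id0 ?intr_eq0 ?lead_coef_eq0 // C0 => /(_ isT) /leq_trans; apply.
    by rewrite (leq_trans (size_poly _ _)) // size_poly.
  - move=> w; rewrite qE => qw; apply: (root_small_coef_le2 EC1).
      by move=> k; rewrite coef_map /= -intr_norm -[1]/(1%:~R) ler_int.
    rewrite ratE; apply: root_dvdp qw; rewrite dvdp_map.
    by rewrite -qP -ratE.
(* The recurrence for [p = 1] bounds the degree of [m] by [D], and each linear factor of [m] divides
   [X (X^P - 1)]; hence [m] divides the [D]-th power, whatever the multiplicities. *)
have Iend : annihilates sC (('X * ('X^(N`!) - 1)) ^+ D).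
  suff /dvdpP[h ->] : m %| ('X * ('X^(N`!) - 1)) ^+ D by apply: annihilatesMl.
  have [rs mE] := closed_field_poly_normal m.
  rewrite mE dvdpZl ?lead_coef_eq0 //.
  have rsD : (size rs <= D)%N.
    have [|c [[i iD ci0] /lift/minm]] := cs 1%N; first by rewrite N0.
    rewrite expr1 comp_polyXr => /dvdp_leq.
    rewrite map_poly_eq0_id0 ?intr_eq0 ?lead_coef_eq0 // (nz _ _ _ _ ci0) // => /(_ isT).
    rewrite {1}mE size_scale ?lead_coef_eq0 // size_prod_XsubC => /leq_trans.
    by move=> /(_ D.+1); rewrite ltnS; apply; rewrite (leq_trans (size_poly _ _)) // size_poly.
  have rsP : {in rs, forall z, root ('X * ('X^(N`!) - 1)) z}.
    move=> z zrs; rewrite /root !hornerE; apply/eqP/rootm.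
    by rewrite mE rootZ ?lead_coef_eq0 // root_prod_XsubC.
  move: ('X * _) rsP => g rsP; apply: (@dvdp_trans _ (g ^+ size rs)); last exact: dvdp_exp2l.
  elim: rs {mE rsD} rsP => [|z rs IH] rsP; first by rewrite big_nil dvd1p.
  rewrite big_cons exprS dvdp_mul ?IH // => [|y yrs]; last by rewrite rsP // inE yrs orbT.
  by rewrite dvdp_XsubCl rsP // mem_head.
(* Under [seq_form], the difference operator is multiplication by [X (X^P - 1)]. *)
have iterE k l : (iter k (fun r i => r (i + N`!).+1 - r i.+1) s l)%:~R =
    seq_form sC ('X^l * ('X * ('X^(N`!) - 1)) ^+ k).
  elim: k l => [|k IH] l; first by rewrite mulr1 seq_formXn.
  rewrite iterS intrB !IH -linearB /=; congr seq_form.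
  by rewrite !exprS exprD; ring.
by move=> l; apply/eqP; rewrite -(intr_eq0 algC) iterE Iend.
Qed.

Local Open Scope classical_set_scope.
Local Open Scope ring_scope.

(** * Growth rates *)

Section Fekete.
Variables (R : realType) (g : nat -> R).
Hypotheses (g1 : forall n, 1 <= g n) (g_ndecr : {homo g : m n / (m <= n)%N >-> m <= n})
  (gM : forall m n, g (m + n)%N <= g m * g n).
Let b n := g n `^ n%:R^-1.

Let g0 n : 0 <= g n. Proof. exact: le_trans (g1 n). Qed.

Let bX n : (0 < n)%N -> b n ^+ n = g n.
Proof.
by move=> n0; rewrite -powR_mulrn ?powR_ge0 // -powRrM mulVf ?powRr1 ?pnatr_eq0 -?lt0n.
Qed.

Let b1 n : 1 <= b n.
Proof. by have := @ge0_ler_powR R n%:R^-1 _ 1 (g n); rewrite powR1 !nnegrE; apply. Qed.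

(** With [q = n %/ m + 1], submultiplicativity gives [g n <= g (m q) <= (b m)^(m q)], and
    [m q <= n + m]; then take [n]-th roots. *)
Let le_bb m n : (0 < m)%N -> (0 < n)%N -> b n <= b m `^ (1 + m%:R / n%:R).
Proof.
move=> m0 n0.
have gX k : g (m * k.+1)%N <= g m ^+ k.+1.
  elim: k => [|k IH]; first by rewrite muln1 expr1.
  by rewrite mulnS exprS (le_trans (gM _ _)) // ler_wpM2l.
have : g n <= b m `^ (m * (n %/ m).+1)%N%:R.
  rewrite powR_mulrn ?powR_ge0 // exprM bX // -[n in g n]/n.
  by apply: le_trans (gX _); apply: g_ndecr; rewrite mulnC ltnW // ltn_ceil.
move=> h; apply: (le_trans (y := (b m `^ (m * (n %/ m).+1)%N%:R) `^ n%:R^-1)).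
  by rewrite ge0_ler_powR ?nnegrE ?powR_ge0.
rewrite -powRrM ler_powR // ler_pdivrMr ?ltr0n // mulrDl mul1r divfK ?pnatr_eq0 -?lt0n //.
by rewrite -natrD ler_nat mulnS addnC leq_add2r mulnC leq_trunc_div.
Qed.

(** The limit is the infimum of the [b n]: pick [m] with [b m] close to it; by [le_bb] all later
    [b n] lie below a quantity tending to [b m]. *)
Lemma fekete : exists l : R,
  (b @ \oo --> l)%classic /\ forall n, (0 < n)%N -> l <= b n.
Proof.
pose B : set R := [set b n | n in [set n | (0 < n)%N]]%classic.
have B0 : (B !=set0)%classic by exists (b 1), 1%N.
have B1 : has_lbound B by exists 1 => _ [n _ <-].
exists (inf B); have leB n : (0 < n)%N -> inf B <= b n by move=> n0; apply: ge_inf => //; exists n.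
split=> //; apply/cvgrPdist_lt => eps eps0.
have [_ [m /= m0 <-] bm] := inf_adherent eps0 (conj B0 B1).
have : (fun n : nat => b m `^ (1 + m%:R / n%:R)) @ \oo --> b m.
  rewrite -[X in _ --> X](powRr1 (le_trans ler01 (b1 m))).
  have bm0 : b m != 0 by rewrite gt_eqF // (lt_le_trans ltr01).
  rewrite /powR (negbTE bm0).
  apply: (@cvg_comp _ _ _ (fun n : nat => (1 + m%:R / n%:R) * ln (b m)) expR); last exact: continuous_expR.
  apply: cvgMl; rewrite -[X in _ --> X]addr0; apply: cvgD; first exact: cvg_cst.
  rewrite -(mulr0 m%:R); apply: cvgMr.
  by rewrite -(cvg_shiftS (fun n => n%:R^-1 : R)); exact: cvg_harmonic.
move/cvgrPdist_lt => /(_ (inf B + eps - b m)); rewrite subr_gt0 => /(_ bm) h.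
near=> n.
have n0 : (0 < n)%N by near: n; exists 1%N.
rewrite distrC ger0_norm ?subr_ge0 ?leB // ltrBlDl.
apply: (le_lt_trans (le_bb m0 n0)).
have : `|b m - b m `^ (1 + m%:R / n%:R)| < inf B + eps - b m by near: n.
by rewrite distrC => /(le_lt_trans (ler_norm _)); rewrite ltrD2r.
Unshelve. all: by end_near. Qed.

End Fekete.

Local Open Scope group_scope.

(** * Word balls and the growth rate of a finite set *)

Section Balls.
Variable G : groupType.
Implicit Types (A : {fset G}) (x y : G).

Lemma ball_one A n : Defs.ball A n 1.
Proof. by exists [::]; split; rewrite // big_nil. Qed.

Lemma ball_mul A m n x y : Defs.ball A m x -> Defs.ball A n y -> Defs.ball A (m + n) (x * y).
Proof.
move=> [w [wA wm <-]] [v [vA vn <-]]; exists (w ++ v).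
by split; [rewrite /word_over all_cat; apply/andP | rewrite size_cat leq_add | rewrite big_cat].
Qed.

Lemma ball_inv A n x : Defs.ball A n x -> Defs.ball A n x^-1.
Proof.
move=> [w [wA wn <-]]; exists [seq a^-1 | a <- rev w]; split.
- rewrite /word_over all_map all_rev; apply: sub_all wA => a /=.
  by rewrite invgK orbC.
- by rewrite size_map size_rev.
- by rewrite big_map prodgV revK.
Qed.

Lemma ball_gen A a : a \in A -> Defs.ball A 1 a.
Proof. by move=> aA; exists [:: a]; split; rewrite ?big_seq1 //= /word_over /= aA. Qed.

Lemma sub_ball A m n x : (m <= n)%N -> Defs.ball A m x -> Defs.ball A n x.
Proof. by move=> mn [w [wA wm <-]]; exists w; split=> //; apply: leq_trans mn. Qed.

Lemma ball_exp A m n x : Defs.ball A m x -> Defs.ball A (n * m) (x ^+ n).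
Proof.
by move=> Ax; elim: n => [|n IH]; [exact: ball_one | rewrite expgS mulSn; apply: ball_mul].
Qed.

Lemma ball_split A m n x : Defs.ball A (m + n) x ->
  exists2 y, Defs.ball A m y & exists2 z, Defs.ball A n z & x = y * z.
Proof.
move=> [w [wA wmn <-]]; move: wA; rewrite -[w in word_over _ w](cat_take_drop m) /word_over all_cat.
move=> /andP[tA dA]; exists (\prod_(a <- take m w) a).
  by exists (take m w); split=> //; rewrite size_take_min geq_minl.
exists (\prod_(a <- drop m w) a); last by rewrite -big_cat cat_take_drop.
by exists (drop m w); split=> //; rewrite size_drop leq_subLR.
Qed.

Lemma mem_ball A n x : (x \in fset_set (Defs.ball A n)) <-> Defs.ball A n x.
Proof. by rewrite in_fset_set; [rewrite inE | exact: finite_ball]. Qed.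

Lemma size_le_growth A n (s : seq G) :
  uniq s -> {in s, forall x, Defs.ball A n x} -> (size s <= growth A n)%N.
Proof.
by move=> us sA; apply: uniq_leq_size => // x xs; apply/mem_ball/sA.
Qed.

Lemma card_le_growth A n (I : finType) (f : I -> G) :
  injective f -> (forall i, Defs.ball A n (f i)) -> (#|I| <= growth A n)%N.
Proof.
move=> f_inj fA; rewrite cardE -(size_map f); apply: size_le_growth.
  by rewrite map_inj_uniq ?enum_uniq.
by move=> _ /mapP[i _ ->].
Qed.

Lemma growth_gt0 A n : (0 < growth A n)%N.
Proof.
apply: (@size_le_growth A n [:: 1]) => // x; rewrite inE => /eqP->; exact: ball_one.
Qed.

Lemma growth_ndecr A m n : (m <= n)%N -> (growth A m <= growth A n)%N.
Proof.
move=> mn; apply: size_le_growth; first exact: fset_uniq.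
by move=> x /mem_ball; exact: sub_ball.
Qed.

Lemma growthD A m n : (growth A (m + n) <= growth A m * growth A n)%N.
Proof.
rewrite /growth -(size_allpairs *%g (fset_set (Defs.ball A m)) (fset_set (Defs.ball A n))).
apply: uniq_leq_size => [|x /mem_ball/ball_split[y /mem_ball Ay [z /mem_ball Az ->]]].
  exact: fset_uniq.
by apply/allpairsP; exists (y, z).
Qed.

Variable R : realType.

Lemma growth_rate_cvg A :
  ((fun n => ((growth A n)%:R `^ n%:R^-1)%R) @ \oo --> growth_rate R A) /\
  forall n, (0 < n)%N -> (growth_rate R A <= (growth A n)%:R `^ n%:R^-1)%R.
Proof.
have [||m n|l [gl lg]] := @fekete R (fun n => (growth A n)%:R)%R.
- by move=> n; rewrite ler1n growth_gt0.
- by move=> m n mn; rewrite ler_nat growth_ndecr.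
- by rewrite -natrM ler_nat growthD.
by have -> : growth_rate R A = l by apply: (cvg_lim (@Rhausdorff R)).
Qed.

Lemma growth_rate_ge1 A : (1 <= growth_rate R A)%R.
Proof.
have [cv _] := growth_rate_cvg A.
apply: (limr_ge (cvgP _ cv)); near=> n.
have := @ge0_ler_powR R n%:R^-1%R _ 1%R (growth A n)%:R%R.
by rewrite powR1 !nnegrE; apply; rewrite ?invr_ge0 ?ler1n ?growth_gt0.
Unshelve. all: by end_near. Qed.

Lemma growth_rate_exp_le A n : (growth_rate R A ^+ n <= (growth A n)%:R)%R.
Proof.
case: n => [|n]; first by rewrite expr0 ler1n growth_gt0.
have [_ /(_ n.+1 isT) h] := growth_rate_cvg A.
apply: (le_trans (lerXn2r n.+1 _ _ h)); rewrite ?nnegrE ?powR_ge0 //.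
  by rewrite (le_trans ler01) // growth_rate_ge1.
by rewrite -powR_mulrn ?powR_ge0 // -powRrM mulVf ?powRr1 ?pnatr_eq0.
Qed.

(** The rate is a limit, so it can be computed along the multiples of [c], where every term with
    [n > 0] is at least the [c]-th root of [r]. *)
Lemma le_growth_rate A c (r : R) : (0 < c)%N -> (0 <= r)%R ->
  (forall n, (r ^+ n <= (growth A (c * n))%:R)%R) -> (r `^ c%:R^-1 <= growth_rate R A)%R.
Proof.
move=> c0 r0 rA; have [cv _] := growth_rate_cvg A.
have cvc : (fun n => ((growth A (c * n)%N)%:R `^ (c * n)%N%:R^-1)%R) @ \oo --> growth_rate R A.
  exact: (cvg_comp (muln c) (fun n => ((growth A n)%:R `^ n%:R^-1)%R) (@cvg_mulnl c c0) cv).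
rewrite -(cvg_lim (@Rhausdorff R) cvc); apply: (limr_ge (cvgP _ cvc)); near=> n.
have n0 : (0 < n)%N by near: n; exists 1%N.
have -> : (r `^ c%:R^-1 = (r ^+ n) `^ (c * n)%N%:R^-1)%R.
  by rewrite -powR_mulrn // -powRrM natrM invfM mulrCA mulfV ?mulr1 // pnatr_eq0 -lt0n.
by rewrite ge0_ler_powR ?nnegrE ?exprn_ge0 ?invr_ge0.
Unshelve. all: by end_near. Qed.

Lemma growth_constant_le A : generates A -> (growth_constant G R <= growth_rate R A)%R.
Proof.
move=> gA; apply: ge_inf; last by exists A.
by exists 1%R => _ [B _ <-]; exact: growth_rate_ge1.
Qed.

Lemma le_growth_constant (k : R) : finitely_generated G ->
  (forall A, generates A -> (k <= growth_rate R A)%R) -> (k <= growth_constant G R)%R.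
Proof.
move=> [A gA] kA; apply: lb_le_inf; first by exists (growth_rate R A), A.
by move=> _ [B gB <-]; exact: kA.
Qed.

End Balls.

Lemma ball_morph (G H : groupType) (f : G -> H) (B : {fset G}) (A : {fset H}) c n x :
  {morph f : x y / x * y} -> {in B, forall b, Defs.ball A c (f b)} ->
  Defs.ball B n x -> Defs.ball A (c * n) (f x).
Proof.
move=> fM BA [w [+ + <-]]; elim: w n => [|b w IH] n /=.
  have -> : f (\prod_(a <- [::]) a) = 1.
    by rewrite big_nil; apply: (@mulgI _ (f 1)); rewrite -fM !mulg1.
  by move=> *; exact: ball_one.
case: n => // n; move=> /andP[bB wB] wn; rewrite big_cons fM mulnS.
apply: ball_mul; last exact: IH.
case/orP: bB => [|bB]; first exact: BA.
rewrite -[b]invgK; have fV y : f y^-1 = (f y)^-1.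
  apply: (@mulgI _ (f y)); rewrite mulgV -fM mulgV.
  by apply: (@mulgI _ (f 1)); rewrite -fM !mulg1.
by rewrite fV; apply/ball_inv/BA.
Qed.

(** The embedding sends the ball of radius [n] for [B] into the ball of radius [c n] for [A]. Thus a
    fast-growing subgroup with short generators forces [A] to grow. *)
Lemma growth_constant_root_le (R : realType) (G H : groupType) (f : G -> H)
    (B : {fset G}) (A : {fset H}) (c : nat) (u : R) :
  {morph f : x y / x * y} -> injective f -> generates B -> (0 < c)%N ->
  {in B, forall b, Defs.ball A c (f b)} -> (0 <= u)%R -> (u <= growth_constant G R)%R ->
  (u `^ c%:R^-1 <= growth_rate R A)%R.
Proof.
move=> fM f_inj gB c0 BA u0 uG; apply: le_growth_rate => // n.
have uB := le_trans uG (growth_constant_le R gB).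
apply: (le_trans (lerXn2r n _ _ uB)); rewrite ?nnegrE ?(le_trans u0) //.
apply: (le_trans (growth_rate_exp_le R B n)); rewrite ler_nat.
rewrite [growth B n]/growth -(size_map f (fset_set (Defs.ball B n))); apply: size_le_growth.
  by rewrite map_inj_uniq ?fset_uniq.
by move=> _ /mapP[x /mem_ball Bx ->]; exact: ball_morph Bx.
Qed.

(** * Subgroups generated by an orbit *)

(** Membership in the generated subgroup, as an inductive predicate in order to reason by induction
    on its elements; [generated_subgroup] turns it into a [groupClosed]. *)
Inductive generated (T : groupType) (X : T -> Prop) : T -> Prop :=
| generated_base x : X x -> generated X x
| generated_one : generated X 1
| generated_mul x y : generated X x -> generated X y -> generated X (x * y)
| generated_inv x : generated X x -> generated X x^-1.

Lemma sub_generated (T : groupType) (X Y : T -> Prop) x :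
  (forall y, X y -> generated Y y) -> generated X x -> generated Y x.
Proof.
move=> XY; elim=> {x} [x /XY//||x y _ Yx _ Yy|x _ Yx]; first exact: generated_one.
  exact: generated_mul.
exact: generated_inv.
Qed.

Lemma generated_prod (T : groupType) (X : T -> Prop) (I : Type) (r : seq I) (P : pred I) (f : I -> T) :
  (forall i, P i -> generated X (f i)) -> generated X (\prod_(i <- r | P i) f i).
Proof. by move=> Xf; apply: big_ind => //; [exact: generated_one | exact: generated_mul]. Qed.

Lemma generated_exp (T : groupType) (X : T -> Prop) x n :
  generated X x -> generated X (x ^+ n).
Proof.
by move=> Xx; elim: n => [|n IH]; [exact: generated_one | rewrite expgS; apply: generated_mul].
Qed.

Lemma generated_expz (T : groupType) (X : T -> Prop) x k :
  generated X x -> generated X (gexpz x k).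
Proof.
by case: k => n Xx /=; [|apply: generated_inv]; apply: generated_exp.
Qed.

Lemma groupClosed_of_Prop (T : groupType) (P : T -> Prop) :
  P 1 -> (forall x y, P x -> P y -> P (x * y)) -> (forall x, P x -> P x^-1) ->
  exists S : groupClosed T, forall x, x \in S <-> P x.
Proof.
move=> P1 PM PV; pose S : {pred T} := fun x => `[< P x >].
have SE x : x \in S <-> P x by rewrite /S unfold_in; split=> /asboolP.
have SM : mulg_closed S by move=> x y /SE Px /SE Py; apply/SE/PM.
have S1 : 1 \in S by apply/SE.
have SV : invg_closed S by move=> x /SE Px; apply/SE/PV.
pose S' : groupClosed T := HB.pack S (isMulClosed.Build T S SM) (isMul1Closed.Build T S S1)
  (isInvClosed.Build T S SV).
by exists S'.
Qed.

Lemma generated_subgroup (T : groupType) (X : T -> Prop) :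
  exists S : groupClosed T, forall x, x \in S <-> generated X x.
Proof.
apply: groupClosed_of_Prop; first exact: generated_one; first exact: generated_mul.
exact: generated_inv.
Qed.

Lemma generated_finitely (T : groupType) (H : groupClosed T) (I : finType) (x : I -> T) :
  (forall g, g \in H <-> generated (fun y => exists i, y = x i) g) ->
  exists2 B : {fset subgroup H}, generates B & {in B, forall b, exists i, val b = x i}.
Proof.
move=> HE; pose B : {fset subgroup H} := seq_fset tt [seq insubd 1 (x i) | i <- enum I].
have xH i : x i \in H by apply/HE/generated_base; exists i.
have BE b : b \in B -> exists2 i, val b = x i & b = insubd 1 (x i).
  by rewrite seq_fsetE => /mapP[i _ ->]; exists i; rewrite ?insubdK.
exists B => [g|b /BE[i ? _]]; last by exists i.
suff gen_w t : generated (fun y => exists i, y = x i) t ->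
    exists2 w : seq (subgroup H), word_over B w & val (\prod_(b <- w) b) = t.
  by have [w wB /val_inj wg] := gen_w _ ((HE (val g)).1 (valP g)); exists w.
elim=> {t} [_ [i ->]||t t' _ [w wB <-] _ [w' w'B <-]|t _ [w wB <-]].
- exists [:: insubd 1 (x i)]; last by rewrite big_seq1 insubdK ?xH.
  rewrite /word_over /= andbT; apply/orP; left; rewrite seq_fsetE.
  by apply/mapP; exists i; rewrite ?mem_enum.
- by exists [::]; rewrite // big_nil.
- exists (w ++ w'); first by rewrite /word_over all_cat; apply/andP.
  by rewrite big_cat.
- have : Defs.ball B (size w) (\prod_(b <- w) b) by exists w.
  by move=> /ball_inv[v [vB _ vE]]; exists v; rewrite // vE.
Qed.

(** * Integer-valued functions, total on the group but additive only on a generated subgroup *)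

Section IntegerValued.
Variables (T : groupType) (X : T -> Prop) (F : T -> int).
Hypothesis FM : forall x y, generated X x -> generated X y -> F (x * y) = (F x + F y)%R.

Lemma int_additive1 : F 1 = 0%R.
Proof.
have X1 := generated_one X.
by apply/(@addrI _ (F 1)); rewrite addr0 -FM // mulg1.
Qed.

Lemma int_additiveV x : generated X x -> F x^-1 = (- F x)%R.
Proof.
move=> Xx; have XV := generated_inv Xx.
by apply/(@addrI _ (F x)); rewrite subrr -FM // mulgV int_additive1.
Qed.

Lemma int_additive_prod (I : Type) (r : seq I) (f : I -> T) :
  (forall i, generated X (f i)) -> F (\prod_(i <- r) f i) = (\sum_(i <- r) F (f i))%R.
Proof.
move=> Xf; elim: r => [|i r IH]; first by rewrite !big_nil int_additive1.
by rewrite !big_cons FM ?IH //; apply: generated_prod.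
Qed.

Lemma int_additiveX x n : generated X x -> F (x ^+ n) = (F x *+ n)%R.
Proof.
move=> Xx; elim: n => [|n IH]; first exact: int_additive1.
by rewrite expgS FM ?IH ?mulrS //; apply: generated_exp.
Qed.

Lemma int_additive_expz x k : generated X x -> F (gexpz x k) = (k * F x)%R.
Proof.
move=> Xx; have XX n := generated_exp n Xx.
case: k => n; rewrite /gexpz ?int_additiveV // int_additiveX // -mulr_natl ?natz //.
by rewrite NegzE mulNr.
Qed.

Lemma int_additive_eq0 Y x : (forall y, Y y -> generated X y) ->
  (forall y, Y y -> F y = 0%R) -> generated Y x -> F x = 0%R.
Proof.
move=> YX Y0 Yx; suff [] : generated X x /\ F x = 0%R by [].
elim: Yx => {x} [x Yx||x y _ [Xx x0] _ [Xy y0]|x _ [Xx x0]].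
- by split; [exact: YX | exact: Y0].
- by split; [exact: generated_one | exact: int_additive1].
- by split; [exact: generated_mul | rewrite FM // x0 y0].
- by split; [exact: generated_inv | rewrite int_additiveV // x0 oppr0].
Qed.

End IntegerValued.

(** * Conjugates by the powers of one element *)

Section Conjugates.
Variables (T : groupType) (a : T).

(** Since [x ^ g] is [g^-1 x g], this is [a^i y a^-i]. Only non-negative [i] occur, so orbit
    subgroups are stable under conjugation in this one direction. *)
Definition conj_by (i : nat) (y : T) : T := y ^ (a ^- i).

Lemma conj_byM i : {morph conj_by i : x y / x * y}.
Proof. by move=> x y; exact: conjMg. Qed.

Lemma conj_byV i x : conj_by i x^-1 = (conj_by i x)^-1.
Proof. exact: conjVg. Qed.

Lemma conj_byX i n x : conj_by i (x ^+ n) = conj_by i x ^+ n.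
Proof. exact: conjXg. Qed.

Lemma conj_by0 x : conj_by 0 x = x.
Proof. by rewrite /conj_by invg1 conjg1. Qed.

Lemma conj_byD i j x : conj_by i (conj_by j x) = conj_by (i + j) x.
Proof. by rewrite /conj_by -conjgM -invgM -expgnDr. Qed.

Lemma conj_by1 i : conj_by i 1 = 1.
Proof. exact: conj1g. Qed.

Lemma conj_by_expz i x k : conj_by i (gexpz x k) = gexpz (conj_by i x) k.
Proof. by case: k => n /=; rewrite ?conj_byV conj_byX. Qed.

Lemma conj_by_prod i (I : Type) (r : seq I) (f : I -> T) :
  conj_by i (\prod_(j <- r) f j) = \prod_(j <- r) conj_by i (f j).
Proof. exact: conjg_prod. Qed.

Definition orbit_base (y x : T) : Prop := exists i, x = conj_by i y.

Lemma generated_conj_by (X Y : T -> Prop) i x :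
  (forall z, X z -> generated Y (conj_by i z)) -> generated X x -> generated Y (conj_by i x).
Proof.
move=> XY; elim=> {x} [||x y _ Yx _ Yy|x _ Yx]; first exact: XY.
- by rewrite conj_by1; exact: generated_one.
- by rewrite conj_byM; exact: generated_mul.
- by rewrite conj_byV; exact: generated_inv.
Qed.

Lemma orbit_conj_by i y x :
  generated (orbit_base y) x -> generated (orbit_base y) (conj_by i x).
Proof.
apply: generated_conj_by => _ [j ->]; rewrite conj_byD.
by apply: generated_base; exists (i + j)%N.
Qed.

Lemma orbit_mem y i : generated (orbit_base y) (conj_by i y).
Proof. by apply: generated_base; exists i. Qed.

Lemma orbit_self y : generated (orbit_base y) y.
Proof. by rewrite -{2}[y]conj_by0; exact: orbit_mem. Qed.

Lemma orbit_trans y z x :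
  generated (orbit_base y) z -> generated (orbit_base z) x -> generated (orbit_base y) x.
Proof. by move=> yz; apply: sub_generated => _ [i ->]; exact: orbit_conj_by. Qed.

(** Its negation says that, for every [n], the [2^n] subset products of the first [n] conjugates are
    pairwise distinct. *)
Definition subset_product_relation (p : nat) (y : T) : Prop :=
  exists n (e e' : nat -> bool), (exists2 i, (i < n)%N & e i != e' i) /\
    \prod_(0 <= i < n) conj_by (p * i) y ^+ e i = \prod_(0 <= i < n) conj_by (p * i) y ^+ e' i.

(** Cancel the common factors on the right; at the last index where the exponents differ, the
    conjugate occurs on one side only and can be solved for. *)
Lemma last_conjugate_generated p y : subset_product_relation p y ->
  exists m, generated (fun x => exists2 i, (i < m)%N & x = conj_by (p * i) y) (conj_by (p * m) y).
Proof.
move=> [n [e [e' []]]]; elim: n => [|n IH] [i i_n ei]; first by [].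
rewrite !big_nat_recr //=.
have [en|ne] := eqVneq (e n) (e' n).
  rewrite -en => /mulIg; apply: IH; exists i => //.
  by move: i_n; rewrite ltnS leq_eqVlt; case: eqP => // iE; rewrite iE en eqxx in ei.
move=> eq_prod; exists n; pose X x := exists2 i, (i < n)%N & x = conj_by (p * i) y.
rewrite -/(generated X _).
have Xp (f : nat -> bool) : generated X (\prod_(0 <= i < n) conj_by (p * i) y ^+ f i).
  rewrite big_mkord; apply: generated_prod => j _; apply: generated_exp.
  by apply: generated_base; exists j.
move: eq_prod (Xp e) (Xp e'); move: (\prod_(_ <= _ < _) _) (\prod_(_ <= _ < _) _) => u v + Xu Xv.
case: (e n) (e' n) ne => [] [] //= _; rewrite !(expg1, expg0) mulg1.
  by move=> /(canRL (mulKg _)) ->; apply: generated_mul => //; apply: generated_inv.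
by move=> /esym/(canRL (mulKg _)) ->; apply: generated_mul => //; apply: generated_inv.
Qed.

(* A coincidence between subset products puts the last conjugate involved in
   the subgroup generated by the previous ones, hence the orbit subgroup is
   finitely generated and has a non-zero homomorphism to the integers. *)
Lemma orbit_functional y : y != 1 -> subset_product_relation 1 y ->
  (forall H : groupClosed T, (forall x, x \in H <-> generated (orbit_base y) x) ->
     finitely_generated (subgroup H) ->
     exists f : {multiplicative subgroup H -> intgroup}, exists h, f h != 1) ->
  exists2 F : T -> int,
    (forall x x', generated (orbit_base y) x -> generated (orbit_base y) x' ->
       F (x * x') = (F x + F x')%R) & F y != 0%R.
Proof.
move=> y1 /last_conjugate_generated[m]; rewrite mul1n => Xm ind.
have [H HE] := generated_subgroup (orbit_base y).
pose X (x : T) := exists i : 'I_m, x = conj_by i y.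
have {}Xm : generated X (conj_by m y).
  by apply: sub_generated Xm => _ [i im ->]; apply: generated_base; exists (Ordinal im); rewrite mul1n.
(* For [i >= m], conjugating the expression of the [m]-th conjugate by [a^(i - m)] expresses the
   [i]-th one through earlier ones. *)
have XO x : generated (orbit_base y) x -> generated X x.
  apply: sub_generated => _ [i ->]; elim/ltn_ind: i => i IH.
  have [im|mi] := ltnP i m; first by apply: generated_base; exists (Ordinal im).
  rewrite -(subnK mi) -conj_byD; apply: generated_conj_by Xm => _ [j ->].
  by rewrite conj_byD; apply: IH; rewrite -{2}(subnK mi) ltn_add2l.
have [|B gB _] := @generated_finitely T H 'I_m (fun i => conj_by i y).
  move=> g; rewrite HE; split=> [/XO//|].
  by apply: sub_generated => _ [i ->]; exact: orbit_mem.
have [f [h fh]] := ind H HE (ex_intro _ B gB).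
pose F0 (x : T) : int := f (insubd 1 x).
have F0M x x' : generated (orbit_base y) x -> generated (orbit_base y) x' ->
    F0 (x * x') = (F0 x + F0 x')%R.
  move=> /HE xH /HE x'H; rewrite /F0 -[RHS]/(f _ * f _ : intgroup) -gmulfM; congr (f _).
  by apply: val_inj; rewrite valM !insubdK // gpredM.
(* A non-zero [f] cannot vanish on all the generators; if it does not vanish on the [i]-th
   conjugate, precomposing with [conj_by i] makes it non-zero at [y] itself. *)
have [[i Fi]|noF] := pselect (exists i, F0 (conj_by i y) != 0%R).
  exists (fun x => F0 (conj_by i x)) => // x x' Ox Ox'.
  by rewrite conj_byM F0M //; apply: orbit_conj_by.
case/negP: fh; apply/eqP.
have hO : generated (orbit_base y) (val h) by apply/HE/valP.
have -> : h = insubd 1 (val h) by apply: val_inj; rewrite insubdK //; exact: valP.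
apply: (int_additive_eq0 F0M) hO => [x Ox|x [i ->]]; first exact: generated_base.
by apply/eqP/negPn/negP => Fi; apply: noF; exists i.
Qed.

End Conjugates.

(** * Descent along an orbit *)

Section Descent.
Variables (T : groupType) (a : T) (P : nat).
Local Notation conj := (conj_by a).
Local Notation orbit y := (generated (orbit_base a y)).

(* In additive notation, [twist] is multiplication by [t (t ^ P - 1)], where
   [t] maps [x] to [a x a^-1]. *)
Definition twist (w : T) : T := conj 1 (conj P w * w^-1).

Lemma orbit_twist k y w : orbit y w -> orbit y (iter k twist w).
Proof.
move=> yw; elim: k => [|k IH] //=; apply: orbit_conj_by; apply: generated_mul.
  exact: orbit_conj_by.
exact: generated_inv.
Qed.

Variables (y : T) (F : T -> int).
Hypothesis FM : forall x x', orbit y x -> orbit y x' -> F (x * x') = (F x + F x')%R.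

(** Translates twists of [y] into the difference operator of [uniform_kronecker] acting on the
    sequence of values of [F] along the orbit. *)
Lemma functional_twist k l :
  F (conj l (iter k twist y)) =
  iter k (fun (r : nat -> int) i => (r (i + P).+1 - r i.+1)%R) (fun i => F (conj i y)) l.
Proof.
elim: k l => [|k IH] //= l; have Ok : orbit y (iter k twist y) by apply/orbit_twist/orbit_self.
rewrite -!IH conj_byD conj_byM FM ?int_additive1; first last.
- exact/orbit_conj_by/generated_inv.
- exact/orbit_conj_by/orbit_conj_by.
by rewrite conj_byV (int_additiveV FM) ?conj_byD ?addn1 ?addSn //; apply: orbit_conj_by.
Qed.

Lemma functional_expz_relation (p n : nat) (c : nat -> int) (l : nat) :
  \prod_(0 <= i < n) gexpz (conj (p * i) y) (c i) = 1 ->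
  (\sum_(i < n) c i * F (conj (p * i + l) y) = 0)%R.
Proof.
move=> /(congr1 (fun x => F (conj l x))); rewrite conj_by1 (int_additive1 FM) => F0.
rewrite -[RHS]F0 conj_by_prod (int_additive_prod FM) ?big_mkord => [|i]; last first.
  by apply/orbit_conj_by/generated_expz/orbit_mem.
by apply: eq_bigr => i _; rewrite conj_by_expz conj_byD addnC (int_additive_expz FM) //; apply: orbit_mem.
Qed.

(** The difference of two vectors of 0/1 exponents has entries in {-1, 0, 1}. *)
Lemma functional_subset_relation p : subset_product_relation a p y ->
  exists n (e : nat -> int), [/\ forall i, (`|e i| <= 1)%R,
    exists2 i, (i < n)%N & e i != 0%R &
    forall l, (\sum_(i < n) e i * F (conj (p * i + l) y) = 0)%R].
Proof.
move=> [n [e [e' [[i i_n ei] eq_prod]]]]; exists n, (fun i => (e i)%:Z - (e' i)%:Z)%R; split.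
- by move=> j; case: (e j); case: (e' j).
- by exists i => //; move: ei; case: (e i); case: (e' i).
move=> l; have FX (f : nat -> bool) : F (conj l (\prod_(0 <= i < n) conj (p * i) y ^+ f i)) =
    (\sum_(i < n) (f i)%:Z * F (conj (p * i + l) y))%R.
  rewrite conj_by_prod (int_additive_prod FM) ?big_mkord => [|j]; last first.
    by apply/orbit_conj_by/generated_exp/orbit_mem.
  apply: eq_bigr => j _; rewrite conj_byX conj_byD addnC (int_additiveX FM); last exact: orbit_mem.
  by rewrite -mulr_natl natz.
under eq_bigr do rewrite mulrBl.
by rewrite sumrB -!FX eq_prod subrr.
Qed.

End Descent.

Section DescentContradiction.
Variables (T : groupType) (a : T) (N P D : nat).
Hypotheses (N0 : (0 < N)%N) (P0 : (0 < P)%N).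
Local Notation conj := (conj_by a).
Local Notation orbit y := (generated (orbit_base a y)).

Hypothesis kron : forall s : nat -> int,
  (forall p, (0 < p <= N)%N -> exists c : nat -> int,
     (exists2 i, (i <= D)%N & c i != 0%R) /\
     forall l, (\sum_(i < D.+1) c i * s (p * i + l)%N = 0)%R) ->
  (forall p, (0 < p <= N)%N -> exists n (e : nat -> int),
     [/\ forall i, (`|e i| <= 1)%R, exists2 i, (i < n)%N & e i != 0%R &
     forall l, (\sum_(i < n) e i * s (p * i + l)%N = 0)%R]) ->
  forall l, iter D (fun r i => r (i + P).+1 - r i.+1)%R s l = 0%R.

Variable y : T.
Let z (j : nat) := iter (j * D) (twist a P) y.

Hypothesis no_fixed : forall j w, orbit y w -> w != 1 -> (0 < j)%N -> conj j w != w.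
Hypothesis indicable : forall H : groupClosed T,
  (forall x, x \in H -> orbit y x) -> finitely_generated (subgroup H) ->
  (exists h : subgroup H, h != 1) ->
  exists f : {multiplicative subgroup H -> intgroup}, exists h, f h != 1.
Hypothesis y1 : y != 1.
Hypothesis rank_rel : forall j p, (j <= D)%N -> (0 < p <= N)%N -> exists c : nat -> int,
  (exists2 i, (i <= D)%N & c i != 0%R) /\
  \prod_(0 <= i < D.+1) gexpz (conj (p * i) (z j)) (c i) = 1.
Hypothesis subset_rel : forall j p, (j <= D)%N -> (0 < p <= N)%N ->
  subset_product_relation a p (z j).

Let orbit_z i j : (j <= i)%N -> orbit (z j) (z i).
Proof.
by move=> ji; rewrite /z -(subnK ji) mulnDl iterD; apply/orbit_twist/orbit_self.
Qed.

(** A twist of [w] is trivial only if conjugation by [a^P] fixes [w], which [no_fixed] excludes as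
    [P > 0]. *)
Let twist_neq1 k : iter k (twist a P) y != 1.
Proof.
elim: k => [|k IH] //=; rewrite conjg_eq1 mulg_eq1 invgK.
by apply: no_fixed => //; apply/orbit_twist/orbit_self.
Qed.

(** [orbit_functional] yields [F] from the relation with [p = 1]. The values of [F] along the orbit
    of [z j] satisfy both families of recurrences, so [kron] makes [F] vanish on every conjugate of
    [z j.+1], the [D]-fold twist of [z j]. *)
Let functional j : (j <= D)%N -> exists F : T -> int,
  [/\ forall x x', orbit (z j) x -> orbit (z j) x' -> F (x * x') = (F x + F x')%R,
      F (z j) != 0%R & forall x, orbit (z j.+1) x -> F x = 0%R].
Proof.
move=> jD; have Oz x : orbit (z j) x -> orbit y x.
  by apply: orbit_trans; apply: (@orbit_z j 0).
have [|||F FM Fz] := @orbit_functional T a (z j).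
- exact: twist_neq1.
- by apply: subset_rel.
- move=> H HE fgH; apply: indicable => // [x /HE /Oz //|].
  have zH : z j \in H by apply/HE/orbit_self.
  exists (insubd 1 (z j)); apply/eqP => /(congr1 val); rewrite insubdK // val1.
  by apply/eqP/twist_neq1.
exists F; split=> // x; apply: (int_additive_eq0 FM) => [_ [i ->]|_ [i ->]].
  by apply/orbit_conj_by/orbit_z.
rewrite /z mulSn iterD functional_twist //; apply: kron => p pN.
  have [c [c0 cz]] := rank_rel jD pN.
  by exists c; split=> // l; apply: functional_expz_relation.
by apply: functional_subset_relation => //; apply: subset_rel.
Qed.

(** Let [i0] be the least index with a non-zero exponent. The functional attached to [z i0] kills
    all later factors, leaving [c i0 * F (z i0)], which is non-zero. *)
Lemma no_dependent_twists (c : nat -> int) : (exists2 i, (i <= D)%N & c i != 0%R) ->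
  \prod_(0 <= i < D.+1) gexpz (z i) (c i) <> 1.
Proof.
move=> [i iD ci]; have [i0 ci0 min_i0] := ex_minnP (ex_intro (fun i => c i != 0%R) i ci).
have i0D : (i0 <= D)%N := leq_trans (min_i0 i ci) iD.
have [F [FM Fz F0]] := functional i0D.
rewrite (@big_cat_nat _ _ _ i0) ?leqW //= big_nat big1 ?mul1g => [|j /andP[_ ji]]; last first.
  by have [->//|/min_i0] := eqVneq (c j) 0%R; rewrite leqNgt ji.
rewrite big_ltn // => /(congr1 F); rewrite (int_additive1 FM) big_nat.
have Ozj j : (i0 <= j)%N -> orbit (z i0) (gexpz (z j) (c j)).
  by move=> i0j; apply/generated_expz/orbit_z.
set tail := \prod_(_ <= _ < _ | _) _.
have Otail : orbit (z i0) tail by apply: generated_prod => j /andP[/ltnW i0j _]; exact: Ozj.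
have Ftail : F tail = 0%R.
  by apply/F0/generated_prod => j /andP[i0j _]; apply/generated_expz/orbit_z.
rewrite (FM _ _ (Ozj _ (leqnn _)) Otail) Ftail addr0 (int_additive_expz FM _ (orbit_self _ _)) => /eqP.
by rewrite mulf_eq0 (negbTE ci0) (negbTE Fz).
Qed.

End DescentContradiction.

(** * Uniform growth of the extension *)

(** Rank over the rationals gives a relation; [rat_poly_scale], applied to the row read as a
    polynomial, clears its denominators. *)
Lemma int_vectors_dependent (n D : nat) (v : nat -> 'rV[int]_n) : (n <= D)%N ->
  exists c : nat -> int, (exists2 i, (i <= D)%N & c i != 0%R) /\
    (\sum_(i < D.+1) v i *~ c i = 0)%R.
Proof.
move=> nD; pose M : 'M[rat]_(D.+1, n) := (\matrix_(i, j) (v i 0 j)%:~R)%R.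
have : kermx M != 0%R.
  rewrite kermx_eq0 /row_free; apply/negP => /eqP rM.
  by have := rank_leq_col M; rewrite rM leqNgt ltnS nD.
case/rowV0Pn => w /sub_kermxP wM w0.
have [q [b b0 wE]] := rat_poly_scale (rVpoly w).
have wi (i : 'I_D.+1) : (b%:~R * w 0 i = (q`_i)%:~R)%R.
  rewrite -coef_rVpoly_ord wE coefZ coef_map mulrA mulfV ?mul1r //.
  by rewrite intr_eq0.
exists (fun i => q`_i)%R; split.
  have /rV0Pn[i wi0] := w0; exists i; first by rewrite -ltnS.
  by rewrite -(intr_eq0 rat) -wi mulf_neq0 // intr_eq0.
apply/rowP => j; rewrite mxE summxE; apply/eqP; rewrite -(intr_eq0 rat) rmorph_sum /=.
have := congr1 (fun x : 'rV[rat]_n => (b%:~R * x 0 j)%R) wM.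
rewrite !mxE mulr0 mulr_sumr => wMj; rewrite -[X in _ == X]wMj; apply/eqP/eq_bigr => i _.
rewrite !mxE mulrA wi -intrM; congr (_%:~R)%R.
by rewrite -scaler_int !mxE intz.
Qed.

Lemma gmulf_expz (G H : groupType) (f : {multiplicative G -> H}) x k :
  f (gexpz x k) = gexpz (f x) k.
Proof.
have fX n : f (x ^+ n) = f x ^+ n.
  by elim: n => [|n IH]; [exact: gmulf_one | rewrite !expgS gmulfM IH].
by case: k => n /=; rewrite ?gmulf_inv fX.
Qed.

(** A common substitute for [Z^n] and the Klein bottle group: in the latter, squares lie in the
    abelian subgroup generated by [a] and [b^2]. *)
Definition square_abelian (D : nat) (G : groupType) : Prop :=
  exists2 n, (n <= D)%N & exists psi : {multiplicative free_abelian n -> G},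
    forall x, exists v, psi v = x ^+ 2.

Lemma square_abelian_relation (D : nat) (G : groupType) (x : nat -> G) :
  square_abelian D G -> exists c : nat -> int, (exists2 i, (i <= D)%N & c i != 0%R) /\
    \prod_(0 <= i < D.+1) gexpz (x i) (c i) = 1.
Proof.
move=> [n nD [psi psiE]]; have [v vE] := choice (fun i => psiE (x i)).
have [c [[i iD ci] cv]] := int_vectors_dependent (v : nat -> 'rV[int]_n) nD.
(* The relation holds between the squares, hence the doubled exponents. *)
exists (fun i => 2 * c i)%R; split; first by exists i; rewrite ?mulf_neq0.
have psiZ j : gexpz (x j) (2 * c j)%R = psi ((v j : 'rV[int]_n) *~ c j)%R.
  (* Both sides are homomorphisms in the exponent [c j] with the same value at 1. *)
  have eZ1 := @gexpzZ_unique G (x j ^+ 2) (fun k => gexpz (x j) (2 * (k : int))%R).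
  have eZ2 := @gexpzZ_unique G (x j ^+ 2) (fun k => psi ((v j : 'rV[int]_n) *~ (k : int))%R).
  have -> : gexpz (x j) (2 * c j)%R = gexpzZ (x j ^+ 2) (c j).
    apply: eZ1 => [k l|//]; rewrite -gexpzD; congr (gexpz (x j)).
    exact: (@mulrDr int).
  apply/esym/eZ2 => [k l|]; last by rewrite mulr1z vE.
  by rewrite -gmulfM; congr (psi _); exact: (@mulrzDr 'rV[int]_n).
under eq_bigr do rewrite psiZ.
rewrite big_mkord; transitivity (psi (\sum_(i < D.+1) (v i : 'rV[int]_n) *~ c i)%R); last first.
  by rewrite cv; exact: gmulf_one.
exact/esym/(big_morph psi (@gmulfM _ _ psi) (gmulf_one psi)).
Qed.

(** * Word lengths of conjugates, twists and subset products *)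

Section ConjugateLength.
Variables (T : groupType) (A : {fset T}) (a : T).
Hypothesis Aa : Defs.ball A 1 a.

Lemma ball_conj_by l i x : Defs.ball A l x -> Defs.ball A (l + 2 * i) (conj_by a i x).
Proof.
move=> Ax; have Aai : Defs.ball A i (a ^+ i) by rewrite -[X in Defs.ball _ X]muln1; apply: ball_exp.
have -> : (l + 2 * i = i + (l + i))%N by lia.
rewrite /conj_by conjgE invgK; apply: ball_mul => //; apply: ball_mul => //.
exact: ball_inv.
Qed.

Lemma ball_twist P l x : Defs.ball A l x -> Defs.ball A (2 * l + 2 * P + 2) (twist a P x).
Proof.
move=> Ax; have -> : (2 * l + 2 * P + 2 = (l + 2 * P + l) + 2 * 1)%N.
  by lia.
by apply/ball_conj_by/ball_mul; [exact: ball_conj_by | exact: ball_inv].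
Qed.

Lemma ball_iter_twist P l n m x : (n <= m)%N -> Defs.ball A l x ->
  Defs.ball A (iter m (fun i => 2 * i + 2 * P + 2)%N l) (iter n (twist a P) x).
Proof.
move=> nm Ax; apply: (@sub_ball _ _ (iter n (fun i => 2 * i + 2 * P + 2)%N l)).
  rewrite -(subnK nm) iterD; move: (iter n _ l) => k; elim: (m - n)%N => //= j IH.
  by lia.
by elim: n {nm} => //= n; exact: ball_twist.
Qed.

(** The products telescope: multiplied by [a^(p n)], one becomes the product of the [y^(e_i) a^p],
    of length at most [n (l + p)]. The length is therefore linear in [n], although single conjugates
    get long. *)
Lemma subset_products_growth p l y : Defs.ball A l y -> ~ subset_product_relation a p y ->
  forall n, (2 ^ n <= growth A ((l + 2 * p) * n))%N.
Proof.
move=> Ay free n; pose g (t : n.-tuple bool) :=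
  \prod_(0 <= i < n) conj_by a (p * i) y ^+ nth false t i.
have prodA (e : nat -> bool) m :
    Defs.ball A (m * (l + p)) (\prod_(0 <= i < m) conj_by a (p * i) y ^+ e i * a ^+ (p * m)).
  elim: m => [|m IH]; first by rewrite big_nil muln0 mulg1; exact: ball_one.
  rewrite mulSn addnC big_nat_recr //= mulnS [(p + _)%N]addnC expgnDr.
  have -> : conj_by a (p * m) y ^+ e m = a ^+ (p * m) * y ^+ e m * a ^- (p * m).
    by rewrite -conj_byX /conj_by conjgE invgK mulgA.
  rewrite !mulgA mulgVK -[X in Defs.ball _ _ X]mulgA; apply: ball_mul; first exact: IH.
  apply: ball_mul; first by case: (e m); [rewrite expg1 | exact: ball_one].
  by rewrite -[X in Defs.ball _ X]muln1; apply: ball_exp.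
have gA t : Defs.ball A ((l + 2 * p) * n) (g t).
  have -> : ((l + 2 * p) * n = n * (l + p) + p * n)%N.
    by ring.
  rewrite -[g t](mulgK (a ^+ (p * n))); apply: ball_mul; first exact: prodA.
  by apply: ball_inv; rewrite -[X in Defs.ball _ X]muln1; apply: ball_exp.
have -> : (2 ^ n = #|{: n.-tuple bool}|)%N by rewrite card_tuple card_bool.
apply: card_le_growth gA => t t' gtt'.
apply/eqP/negPn/negP => tt'; apply: free; exists n, (nth false t), (nth false t'); split=> //.
apply: contrapT => same; case/negP: tt'; apply/eqP/val_inj.
apply: (@eq_from_nth _ false); rewrite ?size_tuple // => i i_n.
by apply: contrapT => /eqP ne; apply: same; exists i.
Qed.

End ConjugateLength.

(** Apply the dichotomy to the subgroup generated by the [x i]: growth at least [u], with generators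
    of length at most [c], would contradict the bound on the rate of [A]. *)
Lemma kernel_relation (R : realType) (u : R) (D c : nat) (T : groupType)
    (pi : {multiplicative T -> intgroup}) (A : {fset T}) (x : nat -> T) :
  (0 <= u)%R -> (0 < c)%N ->
  (forall H : groupClosed T, (forall h, h \in H -> pi h = 1) -> finitely_generated (subgroup H) ->
     (u <= growth_constant (subgroup H) R)%R \/ square_abelian D (subgroup H)) ->
  (growth_rate R A < u `^ c%:R^-1)%R ->
  (forall i, (i <= D)%N -> pi (x i) = 1 /\ Defs.ball A c (x i)) ->
  exists b : nat -> int, (exists2 i, (i <= D)%N & b i != 0%R) /\
    \prod_(0 <= i < D.+1) gexpz (x i) (b i) = 1.
Proof.
move=> u0 c0 dich rA xP.
pose X g := exists i : 'I_D.+1, g = x i.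
have [H HE] := generated_subgroup X.
have [B gB BE] := @generated_finitely T H 'I_D.+1 (fun i => x i) HE.
case: (dich H).
- move=> h /HE; elim=> {h} [_ [i ->]||h k _ h1 _ k1|h _ h1].
  + by have [] := xP i; rewrite -1?ltnS.
  + exact: gmulf_one.
  + by rewrite gmulfM h1 k1 mulg1.
  + by rewrite gmulf_inv h1 invg1.
- by exists B.
- move=> uH; have BA : {in B, forall b, Defs.ball A c (val b)}.
    by move=> b /BE[i ->]; have [] := xP i; rewrite -1?ltnS.
  have := @growth_constant_root_le R _ _ (val : subgroup H -> T) B A c u
    (@valM _ _ _) val_inj gB c0 BA u0 uH.
  by rewrite leNgt rA.
- move=> /(@square_abelian_relation D _ (fun i => insubd 1 (x i)))[b [bn prod1]].
  exists b; split=> //; have := congr1 val prod1.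
  have vM : {morph (val : subgroup H -> T) : g h / g * h} by move=> g h; exact: valM.
  rewrite val1 (big_morph _ vM (@val1 _ _ _)) => prod_val.
  rewrite -[RHS]prod_val !big_mkord; apply: eq_bigr => i _.
  have vE : val (insubd (1 : subgroup H) (x i)) = x i.
    by rewrite insubdK //; apply/HE/generated_base; exists i.
  have vX n g : val (g ^+ n : subgroup H) = val g ^+ n.
    by elim: n => [|n IH]; rewrite ?val1 // !expgS vM IH.
  have vV g : val (g^-1 : subgroup H) = (val g)^-1.
    by apply: (@mulgI _ (val g)); rewrite -vM !mulgV val1.
  by rewrite -[in LHS]vE; case: (b i) => n /=; rewrite ?vV vX.
Qed.

Lemma gmulf_int_expg (T : groupType) (pi : {multiplicative T -> intgroup}) a n :
  pi a != 1 -> (0 < n)%N -> pi (a ^- n) != 1.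
Proof.
move=> a1 n0; have piX : pi (a ^+ n) = ((pi a : int) *+ n)%R.
  elim: n {n0} => [|n IH]; first exact: gmulf_one.
  by rewrite expgS gmulfM IH mulrS.
rewrite gmulf_inv piX; change ((- ((pi a : int) *+ n))%R != 0%R).
by rewrite oppr_eq0 mulrn_eq0 negb_or -lt0n n0.
Qed.

Lemma gmulf_int_conj (T : groupType) (pi : {multiplicative T -> intgroup}) x g :
  pi (x ^ g) = pi x.
Proof.
rewrite conjgE !gmulfM gmulf_inv.
by change ((- (pi g : int) + (pi x + pi g))%R = pi x); rewrite addrC addrK.
Qed.

Section ShortKernelElement.
Variables (T : groupType) (pi : {multiplicative T -> intgroup}).
Hypothesis no_fixed : forall a x, pi a != 1 -> pi x = 1 -> x != 1 -> x ^ a != x.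
Hypotheses (ker_neq1 : exists2 x, x != 1 & pi x = 1) (pi_neq1 : exists x, pi x != 1).

Lemma generator_neq1 (A : {fset T}) : generates A -> exists2 a, a \in A & pi a != 1.
Proof.
move=> gA; apply: contrapT => noA; have [x] := pi_neq1; case/negP; apply/eqP.
have [w wA <-] := gA x; elim: w wA => [|b w IH]; first by rewrite big_nil gmulf_one.
move=> /= /andP[bA wA]; rewrite big_cons gmulfM IH // mulg1.
apply: contrapT => /eqP b1; apply: noA; case/orP: bA => bA; first by exists b.
by exists b^-1 => //; rewrite gmulf_inv invg_eq1.
Qed.

(** If [a] commuted with all of [A], it would centralise a non-trivial kernel element, against
    [no_fixed]. So some commutator [[~ a, b]], of length 4, is non-trivial; it lies in the kernel
    since the integers are abelian. *)
Lemma short_kernel_element (A : {fset T}) a : generates A -> a \in A -> pi a != 1 ->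
  exists y, [/\ y != 1, pi y = 1 & Defs.ball A 4 y].
Proof.
move=> gA aA a1; have [x x1 pix] := ker_neq1.
have [b bA ab] : exists2 b, b \in A & [~ a, b] != 1.
  apply: contrapT => noB; case/negP: (no_fixed a1 pix x1); apply/eqP.
  suff ax : commute a x by rewrite conjgE -ax mulKg.
  have [w wA <-] := gA x; elim: w wA => [|b w IH]; first by rewrite big_nil => _; exact: commute1.
  move=> /= /andP[bA wA]; rewrite big_cons; apply: commuteM; last exact: IH.
  have commA c : c \in A -> commute a c.
    by move=> cA; apply/commgP/negPn/negP => ac; apply: noB; exists c.
  by case/orP: bA => /commA // ab; rewrite -[b]invgK; apply: commuteV.
exists [~ a, b]; split=> //.
  by rewrite commgEl gmulfM gmulf_int_conj gmulf_inv mulVg.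
rewrite commgEl conjgE; apply: (@ball_mul _ _ 1 3); first exact/ball_inv/ball_gen.
apply: (@ball_mul _ _ 1 2); first exact/ball_inv/ball_gen.
by apply: (@ball_mul _ _ 1 1); apply: ball_gen.
Qed.

End ShortKernelElement.

(** Stated for an abstract homomorphism [pi] to the integers, to be applied to the exponent of [t].
    The bound [k <= u] serves subgroups contained in the base. *)
Lemma extension_growth (R : realType) (u : R) (D : nat) : (1 < u)%R ->
  exists k : R, [/\ (1 < k)%R, (k <= u)%R &
  forall (T : groupType) (pi : {multiplicative T -> intgroup}),
  (forall a x, pi a != 1 -> pi x = 1 -> x != 1 -> x ^ a != x) ->
  (forall H : groupClosed T, (forall h, h \in H -> pi h = 1) ->
     finitely_generated (subgroup H) ->
     (u <= growth_constant (subgroup H) R)%R \/ square_abelian D (subgroup H)) ->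
  (forall H : groupClosed T, (forall h, h \in H -> pi h = 1) ->
     finitely_generated (subgroup H) -> (exists h : subgroup H, h != 1) ->
     exists f : {multiplicative subgroup H -> intgroup}, exists h, f h != 1) ->
  (exists2 x, x != 1 & pi x = 1) -> (exists x, pi x != 1) ->
  finitely_generated T -> (k <= growth_constant T R)%R].
Proof.
move=> u1; have [N [P [N0 P0 kron]]] := uniform_kronecker D.
(* [L] bounds the lengths of [z_0, ..., z_D], obtained by at most [D * D] twists from a word of
   length 4; [c] also allows for conjugation by [a^(p i)] with [p <= N] and [i <= D]. The minimum
   [m] covers both sources of growth: subgroups of the kernel and the [2^n] subset products. *)
pose L := iter (D * D) (fun i => 2 * i + 2 * P + 2)%N 4.
pose c := (L + 2 * (N * D.+1)).+1.
have c0 : (0 < c)%N by [].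
pose m : R := Num.min u 2%R; have m1 : (1 < m)%R by rewrite lt_min u1 ltr1n.
have m0 : (0 <= m)%R by rewrite ltW // (lt_trans ltr01).
exists (m `^ c%:R^-1)%R; split.
- have := @gt0_ltr_powR R c%:R^-1%R _ 1%R m; rewrite powR1 !nnegrE; apply=> //.
  by rewrite invr_gt0 ltr0n.
- apply: (le_trans (y := m)); last by rewrite ge_min lexx.
  by rewrite ler1_powR ?(ltW m1) // invf_le1 ?ltr0n // ler1n.
move=> T pi no_fixed dich indic kerT piT fgT; apply: le_growth_constant => // A gA.
rewrite leNgt; apply/negP => rA.
have [a aA a1] := generator_neq1 piT gA.
have [y [y1 piy y4]] := short_kernel_element no_fixed kerT gA aA a1.
have Aa := ball_gen aA.
have rAw (w : R) : (m <= w)%R -> (growth_rate R A < w `^ c%:R^-1)%R.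
  move=> mw; apply: (lt_le_trans rA); apply: ge0_ler_powR; rewrite ?nnegrE ?invr_ge0 //.
  exact: le_trans mw.
pose z j := iter (j * D) (twist a P) y.
have zA j : (j <= D)%N -> Defs.ball A L (z j).
  by move=> jD; apply: ball_iter_twist => //; rewrite leq_mul2r jD orbT.
have orbit_ker w : generated (orbit_base a y) w -> pi w = 1.
  elim=> {w} [_ [i ->]||w v _ w1 _ v1|w _ w1].
  - by rewrite /conj_by gmulf_int_conj.
  - exact: gmulf_one.
  - by rewrite gmulfM w1 v1 mulg1.
  - by rewrite gmulf_inv w1 invg1.
have piz j : pi (z j) = 1 by apply/orbit_ker/orbit_twist/orbit_self.
have rel x : (forall i, (i <= D)%N -> pi (x i) = 1 /\ Defs.ball A c (x i)) ->
    exists b : nat -> int, (exists2 i, (i <= D)%N & b i != 0%R) /\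
      \prod_(0 <= i < D.+1) gexpz (x i) (b i) = 1.
  apply: kernel_relation dich _ => //; first by rewrite ltW // (lt_trans ltr01).
  by apply: rAw; rewrite ge_min lexx.
have [b [b0 bz]] : exists b : nat -> int, (exists2 i, (i <= D)%N & b i != 0%R) /\
    \prod_(0 <= i < D.+1) gexpz (z i) (b i) = 1.
  apply: rel => i iD; split; first exact: piz.
  by apply: sub_ball (zA i iD); rewrite /c; lia.
apply: (no_dependent_twists N0 P0 kron _ _ y1 _ _ b0 bz).
- move=> j w Ow w1 j0; apply: no_fixed => //; last exact: orbit_ker.
  exact: gmulf_int_expg.
- by move=> H HO; apply: indic => h /HO/orbit_ker.
- move=> j p jD /andP[p0 pN]; apply: (rel (fun i => conj_by a (p * i) (z j))) => i iD.
  rewrite /conj_by gmulf_int_conj; split; first exact: piz.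
  apply: sub_ball (ball_conj_by Aa (p * i) (zA j jD)); rewrite /c leqW // leq_add2l leq_mul2l.
  by rewrite leq_mul // leqW.
- move=> j p jD /andP[p0 pN]; apply: contrapT => /(subset_products_growth Aa (zA j jD)) free.
  have : (2 `^ c%:R^-1 <= growth_rate R A)%R.
    apply: le_growth_rate => // n; rewrite -natrX ler_nat; apply: (leq_trans (free n)).
    by apply: growth_ndecr; rewrite leq_mul2r /c; apply/orP; right; nia.
  by rewrite leNgt rAw // ge_min lexx orbT.
Qed.

(** * Transport to subgroups of the base *)

Lemma multiplicative_of_morph (G H : groupType) (f : G -> H) :
  {morph f : x y / x * y} -> exists g : {multiplicative G -> H}, g = f :> (G -> H).
Proof.
move=> fM.
pose g : {multiplicative G -> H} := HB.pack f (isMultiplicative.Build G H f fM).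
by exists g.
Qed.

Lemma multiplicative_comp (G H L : groupType) (f : {multiplicative G -> H})
    (g : {multiplicative H -> L}) :
  exists h : {multiplicative G -> L}, h = g \o f :> (G -> L).
Proof. by apply: multiplicative_of_morph => x y; rewrite /= !gmulfM. Qed.

Lemma group_iso_of_inj_surj (G H : groupType) (f : {multiplicative G -> H}) :
  injective f -> (forall y, exists x, f x = y) -> group_iso G H.
Proof.
move=> f_inj /choice[g fg]; exists f, g => [x|//].
by apply: f_inj; rewrite fg.
Qed.

Lemma group_iso_sym (G H : groupType) : group_iso G H -> group_iso H G.
Proof.
move=> [f [g fK gK]]; have gM : {morph g : x y / x * y}.
  by move=> x y; apply: (can_inj fK); rewrite gmulfM !gK.
by have [g' gE] := multiplicative_of_morph gM; exists g'; exists f; rewrite gE.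
Qed.

Lemma group_iso_trans (G H L : groupType) : group_iso G H -> group_iso H L -> group_iso G L.
Proof.
move=> [f f_bij] [g g_bij]; have [h hE] := multiplicative_comp f g.
by exists h; rewrite hE; apply: bij_comp.
Qed.

Lemma generates_image (G H : groupType) (f : {multiplicative G -> H}) (A : {fset G}) :
  (forall y, exists x, f x = y) -> generates A ->
  exists2 B : {fset H}, generates B & {in B, forall b, exists2 a, a \in A & b = f a}.
Proof.
move=> f_surj gA; pose B : {fset H} := seq_fset tt [seq f a | a <- A].
exists B => [y|b]; last by rewrite seq_fsetE => /mapP.
have [x <-] := f_surj y; have [w wA <-] := gA x; exists [seq f a | a <- w].
  rewrite /word_over all_map; apply: sub_all wA => a /=.
  rewrite -gmulf_inv !seq_fsetE => /orP[] aA; apply/orP; [left | right]; apply/mapP.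
    by exists a.
  by exists a^-1.
by rewrite big_map (big_morph _ (@gmulfM _ _ f) (gmulf_one f)).
Qed.

Lemma finitely_generated_iso (G H : groupType) :
  group_iso G H -> finitely_generated G -> finitely_generated H.
Proof.
move=> [f [g fK gK]] [A gA].
by have [|B gB _] := generates_image (f := f) _ gA; [move=> y; exists (g y) | exists B].
Qed.

Lemma growth_constant_iso_le (R : realType) (G H : groupType) (u : R) :
  group_iso G H -> finitely_generated G -> (0 <= u)%R ->
  (u <= growth_constant H R)%R -> (u <= growth_constant G R)%R.
Proof.
move=> [f [g fK gK]] fgG u0 uH; apply: le_growth_constant => // A gA.
have [|B gB BA] := generates_image (f := f) _ gA; first by move=> y; exists (g y).
have gM : {morph g : x y / x * y}.
  by move=> x y; apply: (can_inj fK); rewrite gmulfM !gK.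
have := @growth_constant_root_le R _ _ g B A 1 u gM (can_inj gK) gB isT _ u0 uH.
by rewrite invr1 powRr1 //; apply=> _ /BA[a aA ->]; rewrite fK; apply: ball_gen.
Qed.

Lemma klein_bottle_group_iso (G H : groupType) :
  group_iso G H -> is_klein_bottle_group G -> is_klein_bottle_group H.
Proof.
move=> GH [a [b [ab univ]]]; have [g [f gK fK]] := group_iso_sym GH.
have fM : {morph f : x y / x * y}.
  by move=> x y; apply: (can_inj gK); rewrite gmulfM !fK.
have [f' f'E] := multiplicative_of_morph fM.
exists (f' a), (f' b); split=> [|L x y xy].
  by rewrite -!gmulf_inv -!gmulfM ab.
have [h [ha hb h_uniq]] := univ L x y xy.
have [h' h'E] := multiplicative_comp g h; exists h'.
rewrite h'E /= f'E !fK; split=> // k; rewrite -f'E => ka kb t /=.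
have [k' k'E] := multiplicative_comp f' k.
have := h_uniq k'; rewrite k'E /= => /(_ ka kb (g t)).
by rewrite /= f'E gK.
Qed.

Lemma klein_bottle_group_unique (G H : groupType) :
  is_klein_bottle_group G -> is_klein_bottle_group H -> group_iso G H.
Proof.
move=> [a [b [ab uG]]] [c [e [ce uH]]].
have [f [fa fb _]] := uG H c e ce; have [g [gc ge _]] := uH G a b ab.
have [i [_ _ idG]] := uG G a b ab; have [j [_ _ idH]] := uH H c e ce.
have [gf gfE] := multiplicative_comp f g; have [fg fgE] := multiplicative_comp g f.
have [iG iGE] := @multiplicative_of_morph G G id (fun _ _ => erefl).
have [iH iHE] := @multiplicative_of_morph H H id (fun _ _ => erefl).
exists f, g => x.
  have := idG gf; rewrite gfE /= fa fb => /(_ gc ge x) /= ->.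
  by have := idG iG; rewrite iGE /= => /(_ erefl erefl x).
have := idH fg; rewrite fgE /= gc ge => /(_ fa fb x) /= ->.
by have := idH iH; rewrite iHE /= => /(_ erefl erefl x).
Qed.

Lemma square_abelian_iso (D : nat) (G H : groupType) :
  group_iso G H -> square_abelian D G -> square_abelian D H.
Proof.
move=> [f [g fK gK]] [n nD [psi psiE]]; exists n => //.
have [h hE] := multiplicative_comp psi f; exists h => y.
have [v vE] := psiE (g y); exists v.
by rewrite hE /= vE !expg2 gmulfM gK.
Qed.

Lemma square_abelian_free (D n : nat) : (n <= D)%N -> square_abelian D (free_abelian n).
Proof.
move=> nD; exists n => //; have [i iE] := @multiplicative_of_morph (free_abelian n) _ id (fun _ _ => erefl).
by exists i => x; exists (x ^+ 2); rewrite iE.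
Qed.

Lemma autz_flip (n : int) :
  (forall j : intgroup, autz intgroup_flip n j = j) \/
  (forall j : intgroup, autz intgroup_flip n j = intgroup_opp j).
Proof.
elim/int_rec: n => [|n [] IH|n [] IH]; first by left.
- by right=> j; rewrite -addn1 PoszD autzS IH.
- by left=> j; rewrite -addn1 PoszD autzS IH; exact: intgroup_oppK.
- by right=> j; rewrite -addn1 PoszD opprD autzB IH.
- by left=> j; rewrite -addn1 PoszD opprD autzB IH; exact: intgroup_oppK.
Qed.

(** The pairs with even second coordinate form an abelian subgroup, as even powers of the flip are
    trivial, and the square of [(i, n)] has second coordinate [2 n]. *)
Lemma square_abelian_klein (D : nat) : (2 <= D)%N -> square_abelian D (sdprodZ intgroup_flip).
Proof.
move=> D2; exists 2%N => //.
pose g (v : free_abelian 2) : sdprodZ intgroup_flip :=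
  ((v : 'rV[int]_2) 0 0, (v : 'rV[int]_2) 0 1 + (v : 'rV[int]_2) 0 1)%R.
have autz_even n (j : intgroup) : autz intgroup_flip (n + n)%R j = j.
  by rewrite autzD; case: (autz_flip n) => nE; rewrite !nE //; exact: intgroup_oppK.
have gM : {morph g : x y / x * y}.
  move=> x y; rewrite sdprodZ_mulE /g /= autz_even; congr pair; first by rewrite [LHS]mxE.
  by rewrite ![((x * y)%g : 'rV[int]_2) _ _]mxE addrACA.
have [psi psiE] := multiplicative_of_morph gM; exists psi => -[i n].
have sqE (j : int) : autz intgroup_flip n i = (j : intgroup) -> exists v, psi v = ((i, n) : sdprodZ intgroup_flip) ^+ 2.
  move=> nj; exists ((\row_(l < 2) (if l == 0 then (i : int) + j else n))%R : free_abelian 2).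
  by rewrite psiE /g !mxE /= expg2 sdprodZ_mulE /= nj.
exact: sqE erefl.
Qed.

(** The least positive value [m] of [pi] generates its image, by Euclidean division; as [pi] is
    injective, a preimage [y] of [m] generates [G]. *)
Lemma infinite_cyclic_iso (G : groupType) (pi : {multiplicative G -> intgroup}) :
  (forall x, pi x = 1 -> x = 1) -> (exists x, pi x != 1) -> group_iso G (free_abelian 1).
Proof.
move=> pi_inj [x pix].
pose P n := `[< (0 < n)%N /\ exists y, pi y = (Posz n : intgroup) >].
have exP : exists n, P n.
  exists (absz (pi x : int)); apply/asboolP; rewrite absz_gt0; split=> //.
  have [x0|x0] := leP 0%R (pi x : int); first by exists x; rewrite gez0_abs.
  by exists x^-1; rewrite gmulf_inv ltz0_abs.
case: (ex_minnP exP) => m /asboolP[m0 [y piy]] min_m.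
have piZ k : pi (gexpz y k) = (k * m%:Z)%R.
  have -> : pi (gexpz y k) = gexpz (pi y) k by exact: gmulf_expz.
  pose f (k : intgroup) : intgroup := ((k : int) * m%:Z)%R.
  have fM : {morph f : k l / k * l} by move=> k1 k2; exact: mulrDl.
  have f1 : f (1%R : int) = pi y by rewrite piy /f mul1r.
  exact/esym/(gexpzZ_unique fM f1).
have gM : {morph (fun v : free_abelian 1 => gexpz y ((v : 'rV[int]_1) ord0 ord0)) : v w / v * w}.
  by move=> v w; rewrite -gexpzD; congr gexpz; rewrite [LHS]mxE.
have [g gE] := multiplicative_of_morph gM.
apply/group_iso_sym/(@group_iso_of_inj_surj _ _ g) => [v w|z]; rewrite gE.
  have m_neq0 : m%:Z%R != 0%R by rewrite eqz_nat -lt0n.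
  move=> /(congr1 pi); rewrite !piZ => /(mulIf m_neq0) vw.
  by apply/rowP => i; rewrite !ord1.
exists ((\row_(i < 1) ((pi z : int) %/ m%:Z)%Z)%R : free_abelian 1); rewrite mxE.
set q := (_ %/ _)%Z; apply/divg1_eq/pi_inj.
rewrite gmulfM gmulf_inv piZ; change ((q * m%:Z - (pi z : int))%R = 0%R).
apply/eqP; rewrite subr_eq0 eq_sym [X in X == _](divz_eq _ m%:Z) -subr_eq0 addrC addKr.
have : (0 <= ((pi z : int) %% m%:Z)%Z)%R by rewrite modz_ge0 // eqz_nat -lt0n.
have : (((pi z : int) %% m%:Z)%Z < m%:Z)%R by rewrite ltz_pmod.
have : exists h, pi h = (((pi z : int) %% m%:Z)%Z : intgroup).
  exists (z * (gexpz y q)^-1); rewrite gmulfM gmulf_inv piZ.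
  change (((pi z : int) - q * m%:Z)%R = ((pi z : int) %% m%:Z)%Z).
  by rewrite {1}(divz_eq (pi z : int) m%:Z) -/q addrAC subrr add0r.
case: ((pi z : int) %% m%:Z)%Z => // r ex_r rm _; rewrite eqz_nat; apply: contraTT rm => r0.
by rewrite ltz_nat -leqNgt; apply: min_m; apply/asboolP; split; rewrite ?lt0n.
Qed.

Lemma embedding_image_iso (G K : groupType) (phi : {multiplicative G -> K}) :
  injective phi -> exists H : groupClosed K, group_iso G (subgroup H).
Proof.
move=> phi_inj.
have [|x y [x' <-] [y' <-]|x [x' <-]|H HE] := @groupClosed_of_Prop K (fun y => exists x, phi x = y).
- by exists 1; exact: gmulf_one.
- by exists (x' * y'); rewrite gmulfM.
- by exists x'^-1; rewrite gmulf_inv.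
exists H; have phiH x : phi x \in H by apply/HE; exists x.
pose f x : subgroup H := insubd 1 (phi x).
have fE x : val (f x) = phi x by rewrite insubdK.
have fM : {morph f : x y / x * y}.
  by move=> x y; apply: val_inj; rewrite valM !fE gmulfM.
have [g gE] := multiplicative_of_morph fM.
apply: (@group_iso_of_inj_surj _ _ g) => [x y|h]; rewrite gE.
  by move=> /(congr1 val); rewrite !fE; exact: phi_inj.
have [x xh] : exists x, phi x = val h by apply/HE; exact: (valP h).
by exists x; apply: val_inj; rewrite fE.
Qed.

(** * Groups embedded in the base inherit its hypotheses *)

Section Embedded.
Variables (R : realType) (u : R) (d : nat) (K : groupType).
Hypothesis indicable : locally_indicable K.
Hypothesis trichotomy : forall H : groupClosed K, finitely_generated (subgroup H) ->
  [\/ (u <= growth_constant (subgroup H) R)%R,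
      exists2 n : nat, (n <= d)%N & group_iso (subgroup H) (free_abelian n) |
      is_klein_bottle_group (subgroup H)].
Variables (G : groupType) (phi : {multiplicative G -> K}).
Hypotheses (phi_inj : injective phi) (fgG : finitely_generated G).

Lemma embedded_trichotomy : (0 <= u)%R ->
  [\/ (u <= growth_constant G R)%R,
      exists2 n : nat, (n <= d)%N & group_iso G (free_abelian n) |
      is_klein_bottle_group G].
Proof.
move=> u0; have [H GH] := embedding_image_iso phi_inj.
case: (trichotomy (finitely_generated_iso GH fgG)) => [uH|[n nd Hn]|kH].
- by constructor 1; apply: growth_constant_iso_le uH.
- by constructor 2; exists n => //; apply: group_iso_trans Hn.
- by constructor 3; apply: klein_bottle_group_iso kH; apply: group_iso_sym.
Qed.

Lemma embedded_square_abelian D : (0 <= u)%R -> (d <= D)%N -> (2 <= D)%N ->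
  (u <= growth_constant G R)%R \/ square_abelian D G.
Proof.
move=> u0 dD D2; case: (embedded_trichotomy u0) => [uG|[n nd Gn]|kG]; [by left| |]; right.
  apply: square_abelian_iso (group_iso_sym Gn) _.
  by apply: square_abelian_free; apply: leq_trans dD.
apply: square_abelian_iso (square_abelian_klein D2).
exact/klein_bottle_group_unique/kG/is_klein_bottle_group_sdprodZ.
Qed.

Lemma embedded_indicable : (exists g : G, g != 1) ->
  exists f : {multiplicative G -> intgroup}, exists g, f g != 1.
Proof.
move=> [g g1]; have [H GH] := embedding_image_iso phi_inj.
have [i [j iK jK]] := GH.
have [|f f_surj] := indicable (finitely_generated_iso GH fgG).
  exists (i g); apply: contraNneq g1 => /(congr1 j); rewrite iK => ->.
  by rewrite -(gmulf_one i) iK.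
have [h fh] := f_surj (1%R : int); have [k kE] := multiplicative_comp i f.
by exists k, (j h); rewrite kE /= jK fh.
Qed.

End Embedded.

(** * Subgroups of the semidirect product *)

Lemma sdprodZ_commute (K : groupType) (alpha : automorphism K) (a x : sdprodZ alpha) :
  ~ has_periodic_conjugacy_class alpha -> a.2 != 0%R -> x.2 = 0%R -> commute x a -> x = 1.
Proof.
(* The first coordinates give [k l = l alpha^n(k)], so [alpha^n(k)] is the conjugate of [k] by
   [l]. *)
case: a x => [l n] [k m] /= nper n0 ->; rewrite /commute !sdprodZ_mulE /= autz0 => -[lk _].
apply: contrapT => /eqP k1; apply: nper.
exists k, n; split=> //; first by apply: contraNneq k1 => ->.
by exists l; rewrite conjgE lk mulKg.
Qed.

Local Open Scope ring_scope.

Theorem corollary6p2 (R : realType) (u : R) (d : nat) :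
  1 < u -> (0 < d)%N ->
  exists k : R, 1 < k /\
    forall K : groupType,
      finitely_generated K ->
      locally_indicable K ->
      (forall H : groupClosed K, finitely_generated (subgroup H) ->
         [\/ u <= growth_constant (subgroup H) R,
             exists2 n : nat, (n <= d)%N & group_iso (subgroup H) (free_abelian n) |
             is_klein_bottle_group (subgroup H)]) ->
      forall alpha : automorphism K,
        ~ has_periodic_conjugacy_class alpha ->
        forall S : groupClosed (sdprodZ alpha),
          finitely_generated (subgroup S) ->
          [\/ k <= growth_constant (subgroup S) R,
              exists2 n : nat, (n <= d)%N & group_iso (subgroup S) (free_abelian n) |
              is_klein_bottle_group (subgroup S)].
Proof.
move=> u1 d0; pose D := maxn d 2; have u0 : 0 <= u by rewrite ltW // (lt_trans ltr01).
have [k [k1 ku ext]] := extension_growth D u1.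
exists k; split=> // K _ indK triK alpha nper S fgS.
pose p (x : subgroup S) : intgroup := (val x).2.
have pM : {morph p : x y / (x * y)%g} by move=> x y; rewrite /p valM.
have [pi piE] := multiplicative_of_morph pM.
(* Where the exponent of [t] vanishes, the action is trivial and the first coordinate is an
   injective homomorphism to [K]. *)
have embed (G : groupType) (f : {multiplicative G -> subgroup S}) :
    injective f -> (forall g, pi (f g) = 1%g) ->
    exists phi : {multiplicative G -> K}, injective phi.
  move=> f_inj f_ker; pose q g : K := (val (f g)).1.
  have f2 g : (val (f g)).2 = 0 by have := f_ker g; rewrite piE.
  have qM : {morph q : x y / (x * y)%g}.
    by move=> x y; rewrite /q gmulfM valM sdprodZ_mulE /= f2 autz0.
  have [phi phiE] := multiplicative_of_morph qM; exists phi; rewrite phiE => x y qxy.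
  by apply/f_inj/val_inj; move: qxy (f2 x) (f2 y); rewrite /q; case: (val _) (val _) => [? ?] [? ?] /= -> -> ->.
(* If [pi] is trivial on [S], then [S] embeds in [K] and the hypothesis on [K] applies, with
   [k <= u]. *)
have [pi_neq1|pi1] := pselect (exists x, pi x != 1%g); last first.
  have [i iE] := @multiplicative_of_morph (subgroup S) _ id (fun _ _ => erefl).
  have i_inj : injective i by rewrite iE.
  have i_ker g : pi (i g) = 1%g.
    by rewrite iE; apply: contrapT => /eqP g1; apply: pi1; exists g.
  have [phi phi_inj] := embed _ i i_inj i_ker.
  case: (embedded_trichotomy triK phi_inj fgS u0) => [uS|Sn|kS].
  - by constructor 1; apply: le_trans uS.
  - by constructor 2.
  - by constructor 3.
(* If [pi] is injective and non-trivial, [S] is infinite cyclic, which is allowed because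
   [d >= 1]. *)
have [ker_neq1|ker1] := pselect (exists2 x, x != 1%g & pi x = 1%g); last first.
  constructor 2; exists 1%N => //; apply: infinite_cyclic_iso pi_neq1 => x pix.
  by apply: contrapT => /eqP x1; apply: ker1; exists x.
have embedH (H : groupClosed (subgroup S)) : (forall h, h \in H -> pi h = 1%g) ->
    exists phi : {multiplicative subgroup H -> K}, injective phi.
  move=> Hker.
  have [i iE] := @multiplicative_of_morph (subgroup H) (subgroup S) val (fun _ _ => valM _ _).
  have i_inj : injective i by rewrite iE; exact: val_inj.
  by apply: (embed _ i i_inj) => g; rewrite iE; apply/Hker/valP.
constructor 1; apply: (ext _ pi) => //.
- move=> a x; rewrite piE => pia pix; apply: contraNneq => xa; apply/eqP/val_inj.
  apply: (sdprodZ_commute nper pia pix).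
  by rewrite /commute -!valM; congr val; rewrite -{2}xa conjgE mulVKg.
- move=> H /embedH[phi phi_inj] fgH.
  by apply: (embedded_square_abelian triK phi_inj fgH u0); rewrite leq_max leqnn ?orbT.
- by move=> H /embedH[phi phi_inj] fgH; apply: embedded_indicable phi_inj fgH.
Qed.
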